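(* Let $k\in\{1,2,3,\ldots\}\cup\{\infty\}$ and let $(X,\|\cdot\|)$ be a separable real Banach space whose norm $\|\cdot\|$ is $C^k$-smooth. Then every equivalent norm on $X$ can be approximated uniformly on bounded sets by $C^k$-smooth equivalent norms. That is, for every norm $p$ on $X$ equivalent to $\|\cdot\|$, every bounded set $B\subset X$ and every $\delta>0$, there is a norm $q$ on $X$, equivalent to $\|\cdot\|$ and $C^k$-smooth, such that $|p(x)-q(x)|\le\delta$ for all $x\in B$.
   Context: All Banach spaces are real. Smoothness is in the Fréchet sense: a map between (open subsets of) Banach spaces is $C^1$-smooth if it is Fréchet differentiable and its Fréchet derivative is continuous in the operator norm; $C^k$-smooth means $k$ times continuously Fréchet differentiable (inductively), and $C^\infty$-smooth means $C^k$-smooth for all $k\in\mathbb{N}$. A norm $q$ on $X$ is called $C^k$-smooth if it is $C^k$-smooth on $X\setminus\{0\}$. *)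

(* Defs.v *)
From HB Require Import structures.
From mathcomp Require Import all_boot all_order all_algebra.
From mathcomp Require Import all_classical all_reals.
From mathcomp Require Import topology normedtype landau derive.

Set Implicit Arguments.
Unset Strict Implicit.
Unset Printing Implicit Defensive.

Import Order.TTheory GRing.Theory Num.Theory.
Import numFieldNormedType.Exports.

Local Open Scope classical_set_scope.
Local Open Scope ring_scope.

(* [clin X Y]: the continuous linear maps from X to Y, as a subtype of the
   functions X -> Y, made into a normed module by the operator norm. *)

Section ContinuousLinear.
Context {R : realType} (X Y : normedModType R).

Definition is_clin : {pred X -> Y} :=
  [pred f : X -> Y | `[< linear f /\ continuous f >]].

Record clin := Clin { clin_val :> X -> Y; _ : clin_val \in is_clin }.

HB.instance Definition _ := [isSub for clin_val].
HB.instance Definition _ := [Choice of clin by <:].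

Lemma is_clin_submod : submod_closed is_clin.
Proof.
split=> [|a f g /asboolP[lf cf] /asboolP[lg cg]]; apply/asboolP; split.
- by move=> a x y /=; rewrite scaler0 addr0.
- by move=> x; exact: cvg_cst.
- move=> b x y; rewrite !fctE lf lg !scalerDr -!addrA; congr (_ + _).
    by rewrite !scalerA mulrC.
  by rewrite addrCA.
- by move=> x; apply: cvgD; [apply: cvgZl_tmp; exact: cf|exact: cg].
Qed.

HB.instance Definition _ :=
  GRing.isSubmodClosed.Build R (X -> Y) is_clin is_clin_submod.
HB.instance Definition _ := [SubChoice_isSubLmodule of clin by <:].

Lemma clin_linear (f : clin) : linear f.
Proof. by case: f => f /= /asboolP[]. Qed.

Lemma clin_continuous (f : clin) : continuous f.
Proof. by case: f => f /= /asboolP[]. Qed.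

HB.instance Definition _ (f : clin) :=
  GRing.isLinear.Build R X Y *:%R f (@clin_linear f).

Definition opnorm (f : clin) : R :=
  sup [set `|f x| | x in [set x : X | `|x| <= 1]].

Lemma opnorm_has_sup (f : clin) :
  has_sup [set `|f x| | x in [set x : X | `|x| <= 1]].
Proof.
split; first by exists `|f 0|; exists 0 => //=; rewrite normr0.
have /linear_boundedP : bounded_near f (nbhs (0 : X)).
  exact/linear_bounded_continuous/clin_continuous.
move=> /pinfty_ex_gt0[M M0 fM]; exists M => _ [x /= x1 <-].
by rewrite (le_trans (fM x))// ler_piMr// ltW.
Qed.

Lemma opnorm_ub (f : clin) x : `|x| <= 1 -> `|f x| <= opnorm f.
Proof. by move=> x1; apply: (ub_le_sup (opnorm_has_sup f).2); exists x. Qed.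

Lemma opnorm_le (f : clin) M :
  (forall x, `|x| <= 1 -> `|f x| <= M) -> opnorm f <= M.
Proof.
move=> fM; apply: ge_sup; first exact: (opnorm_has_sup f).1.
by move=> _ [x x1 <-]; exact: fM.
Qed.

Lemma opnorm_ge0 f : 0 <= opnorm f.
Proof. by apply: le_trans (@opnorm_ub f 0 _); rewrite ?normr0. Qed.

Lemma opnormD f g : opnorm (f + g) <= opnorm f + opnorm g.
Proof.
apply: opnorm_le => x x1; apply: le_trans (ler_normD _ _) _.
by apply: lerD; exact: opnorm_ub.
Qed.

Lemma opnormZ (l : R) f : opnorm (l *: f) = `|l| * opnorm f.
Proof.
have leZ a g : opnorm (a *: g) <= `|a| * opnorm g.
  apply: opnorm_le => x x1; rewrite [X in `|X|](_ : _ = a *: g x)// normrZ.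
  by rewrite ler_wpM2l// opnorm_ub.
apply/eqP; rewrite eq_le leZ/=; have [->|l0] := eqVneq l 0.
  by rewrite normr0 mul0r opnorm_ge0.
have {1}-> : f = l^-1 *: (l *: f) by rewrite scalerA mulVf// scale1r.
by rewrite -ler_pdivlMl ?normr_gt0// -normfV leZ.
Qed.

Lemma opnorm0_eq0 f : opnorm f = 0 -> f = 0.
Proof.
move=> f0; apply/val_inj/funext => x /=.
have [->|x0] := eqVneq x 0; first by rewrite linear0.
have nx0 : `|x| != 0 by rewrite normr_eq0.
have : `|f (`|x|^-1 *: x)| <= 0.
  by rewrite -f0 opnorm_ub// normrZ normfV normr_id mulVf.
by rewrite normr_le0 linearZ/= scaler_eq0 invr_eq0 (negPf nx0)/= => /eqP.
Qed.

HB.instance Definition _ :=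
  Lmodule_isNormed.Build R clin opnormD opnormZ opnorm0_eq0.

End ContinuousLinear.

Section Smoothness.
Context {R : realType} {X : normedModType R}.

(* Meant for open U: [is_diff x f df] says that f is Frechet differentiable
   at x with differential df. *)
Fixpoint Cn_on (n : nat) (U : set X) (Y : normedModType R) (f : X -> Y) :
    Prop :=
  match n with
  | 0 => forall x, U x -> {for x, continuous f}
  | m.+1 => exists2 df : X -> clin X Y,
      (forall x, U x -> is_diff x f (df x)) & Cn_on m U df
  end.

(* The order of smoothness is [Some n] for a finite n, [None] for infinity. *)
Definition smooth_on (k : option nat) (U : set X) (Y : normedModType R)
    (f : X -> Y) : Prop :=
  if k is Some n then Cn_on n U f else forall n : nat, Cn_on n U f.

Definition smooth_norm (k : option nat) (q : X -> R) : Prop :=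
  smooth_on k (~` [set 0]) q.

Definition is_norm (q : X -> R) : Prop :=
  [/\ forall x y, q (x + y) <= q x + q y,
      forall (a : R) x, q (a *: x) = `|a| * q x
    & forall x, q x = 0 -> x = 0].

Definition norm_equiv (p q : X -> R) : Prop :=
  exists c C : R, [/\ 0 < c, 0 < C & forall x, c * q x <= p x <= C * q x].

End Smoothness.

Definition separable (T : topologicalType) : Prop :=
  exists2 D : set T, countable D & dense D.

(* Main.v *)
Require Import Defs.
From HB Require Import structures.
From mathcomp Require Import all_boot all_order all_algebra.
From mathcomp Require Import all_classical all_reals.
From mathcomp Require Import topology normedtype landau derive.
From mathcomp Require Import sequences realfun exp.
From mathcomp Require Import ring lra.
Import Order.TTheory GRing.Theory Num.Theory.
Import numFieldNormedType.Exports.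
Set Implicit Arguments.
Unset Strict Implicit.
Unset Printing Implicit Defensive.
Local Open Scope classical_set_scope.
Local Open Scope ring_scope.

(* Let [e_i] be dense in X.  Minimizing one coordinate at a time, the penalized
   distance [min_t (phi (x - sum_(i < n) t_i e_i) + eta sum_i t_i^2)], with [phi]
   a copy of the norm flattened near 0, is a convex 1-Lipschitz function [d_n]
   which is as smooth as the norm (implicit function theorem in the single
   variable [t]), and [d_n] tends to 0 pointwise.  By Ekeland's principle the
   dual of X is separable, so there are finite sets [F_n] of functionals below p
   such that every functional [f <= p] is, for all large n, within [tau] of some
   [f'] in [F_n] in norm and within [o(1)] of it on [e_0, ..., e_(n-1)].
   If f supports p at x, then [p x - f' x = (f - f') x] is at most
   [tau d_n x + o(1)].  Hence every x with [p x = 1] satisfies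
   [f' x + tau d_n x > 1 - eps_n] for some n and some [f'] in [F_n], whereas if
   [p x < 1] then, near x, only finitely many n admit such an [f'] since [d_n]
   tends to 0.  So the sum Phi of smooth convex functions, each vanishing outside
   one of these caps and large well inside it, is locally finite on [p < 1], and
   [Phi = 1] is the unit sphere of the approximating norm. *)


(** * Frechet calculus *)

(** The norm need not be strictly convex, so a nearest point in a finite-dimensional subspace need
    not be unique, let alone depend smoothly on [x]. The quadratic penalty repairs this: in the
    variable [t] it bounds the second derivative below by [2 * eta], whatever the norm does. No
    order of smoothness is lost, because the gradient of the minimum is the old gradient at the
    minimizing point and does not involve the derivative of the minimizer. A finite set of
    functionals cannot norm the unit sphere of [p]: [f'] is only close to [f] up to [tau] in norm
    and may fall short of 1 at [x]. The term [tau d_n] makes up for this deficit on the sphere and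
    dies out at every interior point, which is what makes the sum locally finite. Phi is controlled
    only on [p < 1], so the level 1 has to be reached strictly inside. There convexity and
    [Phi 0 = 0] make the radial derivative at least 1, and the level set is as smooth as Phi. The
    construction is made once, from [C^1] smoothness; every order of smoothness of the norm then
    passes to the same new norm, which settles the infinite order. *)

Section BoundedLinear.
Context {R : realType}.
Implicit Types X Y Z : normedModType R.

Lemma nbhs_dist_le X (x : X) (e : R) : 0 < e -> \forall y \near x, `|y - x| <= e.
Proof.
move=> e0; apply/nbhs_ballP; exists e => //= y.
by rewrite -ball_normE /= distrC => /ltW.
Qed.

Lemma clin_le X Y (f : clin X Y) x : `|f x| <= `|f| * `|x|.
Proof.
have [->|x0] := eqVneq x 0; first by rewrite linear0 !normr0 mulr0.
have nx : 0 < `|x| by rewrite normr_gt0.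
have : `|f (`|x|^-1 *: x)| <= opnorm f.
  by rewrite opnorm_ub// normrZ normfV normr_id mulVf ?gt_eqF.
rewrite linearZ/= normrZ normfV normr_id.
by rewrite ler_pdivrMl// mulrC.
Qed.

Lemma clin_norm_le X Y (f : clin X Y) M :
  0 <= M -> (forall x, `|f x| <= M * `|x|) -> `|f| <= M.
Proof.
move=> M0 fM; apply: opnorm_le => x x1.
by apply: (le_trans (fM x)); rewrite ler_piMr.
Qed.

Lemma is_clin_bounded X Y (f : X -> Y) : linear f ->
  (exists M, forall x, `|f x| <= M * `|x|) -> f \in @is_clin R X Y.
Proof.
move=> lf [M fM]; apply/asboolP; split => //.
pose L := GRing.isLinear.Build R X Y *:%R f lf.
pose F : {linear X -> Y} := HB.pack f L.
suff : continuous F by [].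
apply/linear_bounded_continuous/linear_boundedP.
exists `|M|; split; first exact: num_real.
move=> N MN x; apply: (le_trans (fM x)); apply: ler_wpM2r => //.
by rewrite (le_trans (ler_norm _))// ltW.
Qed.

Definition clin_of X Y (f : X -> Y) (lf : linear f)
  (bf : exists M, forall x, `|f x| <= M * `|x|) : clin X Y :=
  Clin (is_clin_bounded lf bf).

Lemma clinP X Y (f g : clin X Y) : (forall x, f x = g x) -> f = g.
Proof. by move=> fg; apply/val_inj/funext. Qed.

Lemma clinD X Y (f g : clin X Y) x : (f + g) x = f x + g x.
Proof. by []. Qed.

Lemma clinB X Y (f g : clin X Y) x : (f - g) x = f x - g x.
Proof. by []. Qed.

Lemma clinZ X Y (a : R) (f : clin X Y) x : (a *: f) x = a *: f x.
Proof. by []. Qed.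

Lemma clin_addv X Y (f : clin X Y) x y : f (x + y) = f x + f y.
Proof. exact: linearD. Qed.

Lemma clin_subv X Y (f : clin X Y) x y : f (x - y) = f x - f y.
Proof. exact: linearB. Qed.

Lemma clin_scalev X Y (f : clin X Y) a x : f (a *: x) = a *: f x.
Proof. exact: linearZ. Qed.

Lemma clinN X Y (f : clin X Y) x : (- f) x = - f x.
Proof. by []. Qed.

Lemma clin_oppv X Y (f : clin X Y) x : f (- x) = - f x.
Proof. exact: linearN. Qed.

Lemma clin_scaleR X (f : clin X R) (a : R) x : f (a *: x) = a * f x.
Proof. exact: clin_scalev. Qed.

(** The epsilon form of [is_diff], in which remainders can be estimated directly; [near] replaces
    the little-o. *)
Definition fderiv X Y (x : X) (f : X -> Y) (df : clin X Y) :=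
  forall e : R, 0 < e ->
    \forall y \near x, `|f y - f x - df (y - x)| <= e * `|y - x|.

Lemma is_diffE X Y (x : X) (f : X -> Y) (df : clin X Y) :
  is_diff x f df <-> fderiv x f df.
Proof.
split=> [[/diff_locally d dE] e e0|fd].
  move: d; rewrite dE => /eqaddoP/(_ e e0).
  rewrite (near_shift 0 x) /=; apply: filterS => y /=.
  by rewrite !fctE/= subr0 addrK opprD addrA.
have E : f \o shift x = cst (f x) + df +o_ 0 id.
  apply/eqaddoP => e e0; have := fd e e0.
  rewrite (near_shift 0 x) /=; apply: filterS => y /=.
  by rewrite !fctE/= subr0 addrK opprD addrA.
have dE : 'd f x = df :> (X -> Y).
  by apply: diff_unique => //; exact: clin_continuous.
apply: DiffDef => //; apply/diff_locallyP; split; rewrite dE //.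
exact: clin_continuous.
Qed.

Lemma fderiv_lip X Y (x : X) (f : X -> Y) (df : clin X Y) : fderiv x f df ->
  \forall y \near x, `|f y - f x| <= (`|df| + 1) * `|y - x|.
Proof.
move=> /(_ 1 ltr01); apply: filterS => y; rewrite mul1r => h.
rewrite -(subrK (df (y - x)) (f y - f x)) (le_trans (ler_normD _ _))//.
by rewrite mulrDl mul1r addrC lerD// clin_le.
Qed.

Lemma fderiv_eq X Y (f : X -> Y) x (df dg : clin X Y) :
  fderiv x f df -> (forall h, df h = dg h) -> fderiv x f dg.
Proof. by move=> fd /clinP <-. Qed.

Lemma fderiv_continuous X Y (x : X) (f : X -> Y) (df : clin X Y) :
  fderiv x f df -> {for x, continuous f}.
Proof.
by move=> /is_diffE d; apply: differentiable_continuous; exact: ex_diff.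
Qed.

Lemma fderiv_near X Y (x : X) (f g : X -> Y) (df : clin X Y) :
  (\forall y \near x, f y = g y) -> fderiv x f df -> fderiv x g df.
Proof.
move=> fg fd e e0; have := fd e e0; have := nbhs_singleton fg.
by move=> E; apply: filterS2 fg => y <-; rewrite -E.
Qed.

End BoundedLinear.

Section SmoothCalculus.
Context {R : realType} {X : normedModType R}.
Implicit Types (Y Z : normedModType R) (U V : set X).

Lemma Cn_onS n U V Y (f : X -> Y) : U `<=` V -> Cn_on n V f -> Cn_on n U f.
Proof.
elim: n Y f => [|n IH] Y f UV /=; first by move=> fc x /UV; exact: fc.
by case=> df fd /(IH _ _ UV) dfn; exists df => // x /UV; exact: fd.
Qed.

Lemma Cn_on_congr n U Y (f g : X -> Y) : open U ->
  (forall x, U x -> f x = g x) -> Cn_on n U f -> Cn_on n U g.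
Proof.
move=> oU fg; have nfg x : U x -> \forall y \near x, f y = g y.
  by move=> Ux; apply: filterS (fg) _; exact: open_nbhs_nbhs.
case: n => [|n] /=.
  move=> fc x Ux; have := fc x Ux; rewrite /prop_for/continuous_at -fg//.
  by apply: cvg_trans; apply: near_eq_cvg; exact: nfg.
case=> df fd dfn; exists df => // x Ux; apply/is_diffE.
by apply: fderiv_near (nfg x Ux) _; apply/is_diffE; exact: fd.
Qed.

Lemma Cn_onW n U Y (f : X -> Y) : Cn_on n.+1 U f -> Cn_on n U f.
Proof.
elim: n Y f => [|n IH] Y f [df fd dfn].
  by move=> x /fd /is_diffE /fderiv_continuous.
by exists df => //; exact: IH.
Qed.

Lemma Cn_onSn_continuous n U Y (f : X -> Y) : Cn_on n U f ->
  forall x, U x -> {for x, continuous f}.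
Proof. by elim: n => // n IH /Cn_onW. Qed.

Lemma Cn_on_leq m n U Y (f : X -> Y) : (m <= n)%N ->
  Cn_on n U f -> Cn_on m U f.
Proof.
elim: n => [|n IH]; first by rewrite leqn0 => /eqP ->.
by rewrite leq_eqVlt => /predU1P[->//|]; rewrite ltnS => /IH{}IH /Cn_onW /IH.
Qed.

(* The differentials furnished by the local hypotheses agree wherever they
   exist, so choosing them pointwise glues them together. *)
Lemma Cn_on_local n U Y (f : X -> Y) :
  (forall x, U x -> exists V, [/\ open V, V x & Cn_on n V f]) -> Cn_on n U f.
Proof.
elim: n Y f => [|n IH] Y f loc.
  by move=> x /loc[V [oV Vx]]; apply.
have /choice[df fd] (x : X) : exists df : clin X Y,
    (exists df', is_diff x f (df' : clin X Y)) -> is_diff x f df.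
  have [[df' fd]|nd] := pselect (exists df' : clin X Y, is_diff x f df').
    by exists df'.
  by exists 0 => -[df' fd]; case: nd; exists df'.
exists df => [x /loc[V [_ Vx [df' fd' _]]]|].
  by apply: fd; exists (df' x); exact: fd'.
apply: IH => x /loc[V [oV Vx [df' fd' dfn]]].
exists V; split => //; apply: Cn_on_congr dfn => // y Vy.
have dy := fd' y Vy.
have dy' : is_diff y f (df y) by apply: fd; exists (df' y).
by apply: clinP => z; rewrite -(@diff_val _ _ _ _ _ _ _ dy) -(@diff_val _ _ _ _ _ _ _ dy').
Qed.

Lemma fderiv_cst Y (y : Y) (x : X) : fderiv x (fun=> y) 0.
Proof.
move=> e e0; apply: nearW => z.
by rewrite subrr [X in _ - X](_ : _ = 0)// subr0 normr0 mulr_ge0// ltW.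
Qed.

Lemma Cn_on_cst n U Y (y : Y) : Cn_on n U (fun=> y).
Proof.
elim: n Y y => [|n IH] Y y /=; first by move=> x _; exact: cvg_cst.
exists (fun=> 0); last exact: IH.
by move=> x _; apply/is_diffE; exact: fderiv_cst.
Qed.

Lemma fderiv_clin Y (f : clin X Y) x : fderiv x f f.
Proof.
move=> e e0; apply: nearW => y.
by rewrite clin_subv subrr normr0 mulr_ge0// ltW.
Qed.

Lemma Cn_on_clin n U Y (f : clin X Y) : Cn_on n U f.
Proof.
case: n => [|n] /=; first by move=> x _; exact: clin_continuous.
exists (fun=> f); last exact: Cn_on_cst.
by move=> x _; apply/is_diffE; exact: fderiv_clin.
Qed.

Lemma fderivD Y (f g : X -> Y) x (df dg : clin X Y) :
  fderiv x f df -> fderiv x g dg -> fderiv x (fun y => f y + g y) (df + dg).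
Proof.
move=> fd gd e e0; have e2 : 0 < e / 2 by rewrite divr_gt0.
apply: filterS2 (fd _ e2) (gd _ e2) => y fy gy.
rewrite [e]splitr mulrDl; apply: le_trans (lerD fy gy).
apply: le_trans (ler_normD _ _); rewrite clinD le_eqVlt; apply/orP; left.
apply/eqP; congr (`|_|).
by rewrite !opprD [X in X + _ = _]addrACA [LHS]addrACA.
Qed.

Lemma Cn_onD n U Y (f g : X -> Y) : Cn_on n U f -> Cn_on n U g ->
  Cn_on n U (fun x => f x + g x).
Proof.
elim: n Y f g => [|n IH] Y f g /=.
  by move=> fc gc x Ux; apply: cvgD; [exact: fc|exact: gc].
case=> df fd dfn [dg gd dgn]; exists (fun x => df x + dg x); last exact: IH.
by move=> x Ux; apply/is_diffE/fderivD; apply/is_diffE; [exact: fd|exact: gd].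
Qed.

End SmoothCalculus.


(** * Bounded bilinear maps and the product rule *)

Section BoundedBilinear.
Context {R : realType}.

Record bibounded (Y Z W : normedModType R) (B : Y -> Z -> W) : Prop :=
  Bibounded {
    bibounded_linl : forall z, linear (B^~ z) ;
    bibounded_linr : forall y, linear (B y) ;
    bibounded_le : exists2 M, 0 <= M & forall y z, `|B y z| <= M * (`|y| * `|z|)
  }.

Section Bibounded.
Context (Y Z W : normedModType R) (B : Y -> Z -> W) (bB : bibounded B).

Lemma bibounded_boundl z : exists M, forall y, `|B y z| <= M * `|y|.
Proof.
have [M _ BM] := bibounded_le bB; exists (M * `|z|) => y.
by rewrite -mulrA [`|z| * _]mulrC; exact: BM.
Qed.

Lemma bibounded_boundr y : exists M, forall z, `|B y z| <= M * `|z|.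
Proof.
have [M _ BM] := bibounded_le bB; exists (M * `|y|) => z.
by rewrite -mulrA; exact: BM.
Qed.

Definition bil z : clin Y W := clin_of (bibounded_linl bB z) (bibounded_boundl z).
Definition bir y : clin Z W := clin_of (bibounded_linr bB y) (bibounded_boundr y).

Lemma bibounded_subl y y' z : B (y - y') z = B y z - B y' z.
Proof. exact: (clin_subv (bil z)). Qed.

Lemma bibounded_subr y z z' : B y (z - z') = B y z - B y z'.
Proof. exact: (clin_subv (bir y)). Qed.

Context (X : normedModType R).

Lemma bibounded_compl_proof (a : clin X Y) (z : Z) :
  exists M, forall x, `|B (a x) z| <= M * `|x|.
Proof.
have [M M0 BM] := bibounded_le bB; exists (M * (`|a| * `|z|)) => x.
rewrite (le_trans (BM _ _))// -mulrA ler_wpM2l// mulrAC ler_wpM2r//.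
exact: clin_le.
Qed.

Lemma bibounded_compr_proof (y : Y) (a : clin X Z) :
  exists M, forall x, `|B y (a x)| <= M * `|x|.
Proof.
have [M M0 BM] := bibounded_le bB; exists (M * (`|y| * `|a|)) => x.
by rewrite (le_trans (BM _ _))// -mulrA ler_wpM2l// -mulrA ler_wpM2l// clin_le.
Qed.

Lemma bibounded_compl_lin (a : clin X Y) (z : Z) : linear (fun x => B (a x) z).
Proof. by move=> t x y; rewrite clin_addv clin_scalev (bibounded_linl bB). Qed.

Lemma bibounded_compr_lin (y : Y) (a : clin X Z) : linear (fun x => B y (a x)).
Proof. by move=> t u v; rewrite clin_addv clin_scalev (bibounded_linr bB). Qed.

Definition bibounded_compl a z : clin X W :=
  clin_of (bibounded_compl_lin a z) (bibounded_compl_proof a z).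
Definition bibounded_compr y a : clin X W :=
  clin_of (bibounded_compr_lin y a) (bibounded_compr_proof y a).

Lemma bibounded_compl_bibounded : bibounded bibounded_compl.
Proof.
split=> [z t a b|a t z z'|].
- by apply: clinP => x; exact: (bibounded_linl bB).
- by apply: clinP => x; exact: (bibounded_linr bB).
have [M M0 BM] := bibounded_le bB; exists M => // a z.
apply: clin_norm_le => [|x]; first by rewrite !mulr_ge0.
rewrite (le_trans (BM _ _))// -mulrA ler_wpM2l// mulrAC ler_wpM2r//.
exact: clin_le.
Qed.

Lemma bibounded_compr_bibounded : bibounded bibounded_compr.
Proof.
split=> [z t a b|a t z z'|].
- by apply: clinP => x; exact: (bibounded_linl bB).
- by apply: clinP => x; exact: (bibounded_linr bB).
have [M M0 BM] := bibounded_le bB; exists M => // y a.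
apply: clin_norm_le => [|x]; first by rewrite !mulr_ge0.
by rewrite (le_trans (BM _ _))// -mulrA ler_wpM2l// -mulrA ler_wpM2l// clin_le.
Qed.

Lemma fderiv_bibounded (f : X -> Y) (g : X -> Z) x df dg :
  fderiv x f df -> fderiv x g dg ->
  fderiv x (fun y => B (f y) (g y))
    (bibounded_compl df (g x) + bibounded_compr (f x) dg).
Proof.
move=> fd gd e e0; have [M M0 BM] := bibounded_le bB.
pose C := `|f x| + `|g x| + (`|df| + 1).
have C0 : 0 < C by rewrite /C; have := normr_ge0 (f x);
  have := normr_ge0 (g x); have := normr_ge0 df; lra.
have M1 : 0 < M + 1 by rewrite ltr_wpDl.
pose d := e / ((M + 1) * C).
have d0 : 0 < d by rewrite divr_gt0// mulr_gt0.
have gc0 : \forall y \near x, `|g x - g y| <= d.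
  by have /cvgrPdist_le := fderiv_continuous gd; apply.
have [fd0 gd0 fl0] := And3 (fd _ d0) (gd _ d0) (fderiv_lip fd).
near=> y.
have gc : `|g y - g x| <= d by rewrite distrC; near: y.
have fl : `|f y - f x| <= (`|df| + 1) * `|y - x| by near: y.
have fd' : `|f y - f x - df (y - x)| <= d * `|y - x| by near: y.
have gd' : `|g y - g x - dg (y - x)| <= d * `|y - x| by near: y.
set h := y - x in fl fd' gd' *.
(* Two first-order remainders and one product of increments. The choice of [d] makes their three
   bounds add up to exactly [e] times the norm of [h]. *)
have -> : B (f y) (g y) - B (f x) (g x) -
    (bibounded_compl df (g x) + bibounded_compr (f x) dg) h =
    B (f y - f x - df h) (g x) + B (f x) (g y - g x - dg h)
    + B (f y - f x) (g y - g x).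
  rewrite clinD /= (bibounded_subl _ (df h)) (bibounded_subr _ _ (dg h)).
  have -> : B (f y) (g y) - B (f x) (g x) =
      B (f y - f x) (g y - g x) + B (f y - f x) (g x) + B (f x) (g y - g x).
    by rewrite !bibounded_subr subrK bibounded_subl addrA subrK.
  by rewrite -addrA -addrA [LHS]addrC; congr (_ + _); rewrite addrA opprD addrACA.
have BM' a b u v : `|a| <= u -> `|b| <= v -> `|B a b| <= (M + 1) * (u * v).
  move=> au bv; apply: le_trans (BM a b) _; apply: ler_pM => //.
  - by rewrite mulr_ge0.
  - by rewrite lerDl.
  - exact: ler_pM.
apply: le_trans (ler_normD _ _) _.
apply: le_trans (lerD (ler_normD _ _) (lexx _)) _.
apply: le_trans (lerD (lerD (BM' _ _ _ _ fd' (lexx _)) (BM' _ _ _ _ (lexx _) gd'))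
  (BM' _ _ _ _ fl gc)) _.
have -> : e = d * ((M + 1) * C) by rewrite divfK// gt_eqF// mulr_gt0.
rewrite /C le_eqVlt; apply/orP; left; apply/eqP; ring.
Unshelve. all: by end_near. Qed.

End Bibounded.

(** The derivative of [B (f x) (g x)] is a sum of two expressions of the same kind, for other
    bounded bilinear maps with values in [clin X W]. Hence the induction runs over all spaces and
    all [B] at once. Products, scalings, compositions and evaluations of linear maps are
    instances. *)
Lemma Cn_on_bibounded n (X : normedModType R) (U : set X) :
  forall (Y Z W : normedModType R) (B : Y -> Z -> W), bibounded B ->
  forall (f : X -> Y) (g : X -> Z), Cn_on n U f -> Cn_on n U g ->
  Cn_on n U (fun x => B (f x) (g x)).
Proof.
elim: n => [|n IH] Y Z W B bB f g.
  move=> fc gc x Ux; have [M M0 BM] := bibounded_le bB.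
  apply/cvgrPdist_le => e e0.
  pose C := `|f x| + `|g x| + 1.
  have C0 : 0 < C by rewrite /C; have := normr_ge0 (f x);
    have := normr_ge0 (g x); lra.
  have M1 : 0 < M + 1 by rewrite ltr_wpDl.
  pose d := Num.min 1 (e / ((M + 1) * C)).
  have d0 : 0 < d by rewrite lt_min ltr01 divr_gt0// mulr_gt0.
  have fx0 : \forall y \near x, `|f x - f y| <= d.
    by have /cvgrPdist_le := fc x Ux; apply.
  have gx0 : \forall y \near x, `|g x - g y| <= d.
    by have /cvgrPdist_le := gc x Ux; apply.
  near=> y.
  have fx : `|f x - f y| <= d by near: y.
  have gx : `|g x - g y| <= d by near: y.
  have gy : `|g y| <= `|g x| + d.
    by rewrite -(subrKC (g x) (g y)) (le_trans (ler_normD _ _))// distrC lerD2l.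
  rewrite -(subrKA (B (f x) (g y))) -(bibounded_subr bB) -(bibounded_subl bB).
  rewrite (le_trans (ler_normD _ _))// (le_trans (lerD (BM _ _) (BM _ _)))//.
  have -> : e = (M + 1) * (e / ((M + 1) * C) * C).
    by field; rewrite !gt_eqF.
  rewrite -mulrDr ler_pM//; first by rewrite addr_ge0// mulr_ge0.
    by rewrite lerDl.
  have d1 : d <= 1 by rewrite ge_min lexx.
  apply: (@le_trans _ _ (d * C)); last by rewrite ler_pM2r// ge_min lexx orbT.
  apply: (@le_trans _ _ (`|f x| * d + d * (`|g x| + d))).
    by rewrite lerD// ler_pM.
  rewrite mulrC -mulrDr ler_pM2l// /C; lra.
move=> [df fd dfn] [dg gd dgn].
have Cf : Cn_on n U f by apply: Cn_onW; exists df.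
have Cg : Cn_on n U g by apply: Cn_onW; exists dg.
exists (fun x => bibounded_compl bB (df x) (g x) + bibounded_compr bB (f x) (dg x)).
  move=> x Ux; apply/is_diffE; apply: fderiv_bibounded; apply/is_diffE.
    exact: fd.
  exact: gd.
apply: Cn_onD; apply: IH => //.
  exact: bibounded_compl_bibounded.
exact: bibounded_compr_bibounded.
Unshelve. all: by end_near. Qed.

End BoundedBilinear.



(** * Chain rule, inverses and bootstrapping *)

Section Composition.
Context {R : realType}.
Implicit Types X Y Z : normedModType R.

Lemma clin_comp_lin X Y Z (a : clin Y Z) (b : clin X Y) :
  linear (fun x => a (b x)).
Proof. by move=> t x y; rewrite !clin_addv !clin_scalev. Qed.

Lemma clin_comp_bound X Y Z (a : clin Y Z) (b : clin X Y) :
  exists M, forall x, `|a (b x)| <= M * `|x|.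
Proof.
exists (`|a| * `|b|) => x; rewrite (le_trans (clin_le a _))// -mulrA.
by rewrite ler_wpM2l// clin_le.
Qed.

Definition clin_comp X Y Z (a : clin Y Z) (b : clin X Y) : clin X Z :=
  clin_of (clin_comp_lin a b) (clin_comp_bound a b).

Lemma clin_comp_bibounded X Y Z : bibounded (@clin_comp X Y Z).
Proof.
split=> [b t a a'|a t b b'|].
- by apply: clinP.
- by apply: clinP => x; exact: (linearP a).
exists 1 => // a b; rewrite mul1r; apply: clin_norm_le => [|x].
  by rewrite mulr_ge0.
by rewrite (le_trans (clin_le a _))// -mulrA ler_wpM2l// clin_le.
Qed.

Lemma fderiv_comp X Y Z (f : X -> Y) (g : Y -> Z) x df dg :
  fderiv x f df -> fderiv (f x) g dg ->
  fderiv x (fun y => g (f y)) (clin_comp dg df).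
Proof.
by move=> /is_diffE fd /is_diffE gd; apply/is_diffE.
Qed.

(** The target [Z] varies in the induction, since the chain rule replaces [g] by its derivative,
    which takes values in [clin Y Z], while [f] stays. *)
Lemma Cn_on_comp X Y (U : set X) (V : set Y) (f : X -> Y) n :
  (forall x, U x -> V (f x)) -> Cn_on n U f ->
  forall Z (g : Y -> Z), Cn_on n V g -> Cn_on n U (fun x => g (f x)).
Proof.
move=> UV; elim: n => [|n IH] Cf Z g.
  move=> gc x Ux; apply: continuous_comp; [exact: Cf|exact: gc (UV _ Ux)].
move=> [dg gd dgn]; have := Cf => -[df fd dfn].
exists (fun x => clin_comp (dg (f x)) (df x)).
  move=> x Ux; apply/is_diffE/fderiv_comp; apply/is_diffE; first exact: fd.
  exact: gd (UV _ Ux).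
apply: Cn_on_bibounded => //; first exact: clin_comp_bibounded.
by apply: IH => //; exact: Cn_onW.
Qed.

Lemma scaler_bibounded Y : bibounded (fun (a : R) (y : Y) => a *: y).
Proof.
split=> [y t a a'|a t y y'|].
- by rewrite scalerDl -scalerA.
- by rewrite scalerDr !scalerA mulrC.
by exists 1 => // a y; rewrite mul1r normrZ.
Qed.

Lemma Cn_onZ X Y n (U : set X) (k : X -> R) (f : X -> Y) :
  Cn_on n U k -> Cn_on n U f -> Cn_on n U (fun x => k x *: f x).
Proof. exact/Cn_on_bibounded/scaler_bibounded. Qed.

Lemma Cn_onM X n (U : set X) (f g : X -> R) :
  Cn_on n U f -> Cn_on n U g -> Cn_on n U (fun x => f x * g x).
Proof. exact: (@Cn_onZ X R n U f g). Qed.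

Lemma Cn_on_scale X Y n (U : set X) (k : R) (f : X -> Y) :
  Cn_on n U f -> Cn_on n U (fun x => k *: f x).
Proof. by move=> fn; apply: Cn_onZ => //; exact: Cn_on_cst. Qed.

Lemma clin_id_lin X : linear (fun x : X => x).
Proof. by []. Qed.

Lemma clin_id_bound X : exists M : R, forall x : X, `|x| <= M * `|x|.
Proof. by exists 1 => x; rewrite mul1r. Qed.

Definition clin_id X : clin X X := clin_of (@clin_id_lin X) (@clin_id_bound X).

Lemma Cn_on_id X n (U : set X) : Cn_on n U (fun x : X => x).
Proof. exact: (Cn_on_clin n U (clin_id X)). Qed.

Lemma clin_ev_lin X Y (e : X) : linear (fun f : clin X Y => f e).
Proof. by []. Qed.

Lemma clin_ev_bound X Y (e : X) :
  exists M : R, forall f : clin X Y, `|f e| <= M * `|f|.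
Proof. by exists `|e| => f; rewrite mulrC clin_le. Qed.

Definition clin_ev X Y (e : X) : clin (clin X Y) Y :=
  clin_of (@clin_ev_lin X Y e) (@clin_ev_bound X Y e).

(** Meant for functions defined implicitly, whose differential is an expression in the function
    itself: each order known for [f] holds for [df], which gives the next order for [f]. It serves
    the inverse, the minimizer and the gauge. *)
Lemma Cn_on_bootstrap X Y n (U : set X) (f : X -> Y) (df : X -> clin X Y) :
  (forall x, U x -> {for x, continuous f}) ->
  (forall x, U x -> is_diff x f (df x)) ->
  (forall m, (m < n)%N -> Cn_on m U f -> Cn_on m U df) -> Cn_on n U f.
Proof.
move=> fc fd; elim: n => [_|n IH boot]; [exact: fc|exists df => //].
apply: (boot) => //; apply: IH => m mn; apply: boot; exact: ltnW.
Qed.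

Lemma Cn_on_inv n : Cn_on n (~` [set (0 : R)]) (@GRing.inv R).
Proof.
apply: (@Cn_on_bootstrap _ _ _ _ _ (fun x : R => (- 1 * (x^-1 * x^-1)) *: clin_id R)).
- by move=> x /eqP x0; exact: inv_continuous.
- move=> x /eqP x0; apply: DiffDef; first exact: differentiable_Rinv.
  rewrite diff_Rinv//; apply/funext => h /=.
  by rewrite /GRing.scale/= mulN1r -invfM expr2.
move=> m _ iV; apply: Cn_onZ; last exact: Cn_on_cst.
by apply: Cn_onM; [exact: Cn_on_cst|exact: Cn_onM].
Qed.

Lemma Cn_onV X n (U : set X) (f : X -> R) : (forall x, U x -> f x != 0) ->
  Cn_on n U f -> Cn_on n U (fun x => (f x)^-1).
Proof.
move=> f0 fn; apply: (Cn_on_comp (V := ~` [set 0])) => //.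
  by move=> x /f0 /eqP.
exact: Cn_on_inv.
Qed.

Lemma Cn_on_sum X Y n (U : set X) I (s : seq I) (f : I -> X -> Y) :
  (forall i, Cn_on n U (f i)) -> Cn_on n U (fun x => \sum_(i <- s) f i x).
Proof.
move=> fn; elim: s => [|i s IH].
  by under eq_fun do rewrite big_nil; exact: Cn_on_cst.
by under eq_fun do rewrite big_cons; exact: Cn_onD.
Qed.

End Composition.

(** * Tangents of convex functions *)

Section Convex.
Context {R : realType} {X : normedModType R}.

Definition convex_on (O : set X) (f : X -> R) := forall x y t, O x -> O y ->
  0 <= t <= 1 -> f (x + t *: (y - x)) <= f x + t * (f y - f x).

Lemma fderiv_convex_le (O : set X) (f : X -> R) (df : clin X R) x y :
  convex_on O f -> O x -> O y -> fderiv x f df -> f x + df (y - x) <= f y.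
Proof.
move=> fO Ox Oy fd; apply/ler_addgt0Pr => e e0.
set h := y - x; pose d := e / (`|h| + 1).
have h1 : 0 < `|h| + 1 by rewrite ltr_wpDl.
have d0 : 0 < d by rewrite divr_gt0.
have /nbhs_ballP[r /= r0 fr] := fd d d0.
pose t := Num.min 1 (r / 2 / (`|h| + 1)).
have t0 : 0 < t by rewrite lt_min ltr01 !divr_gt0.
have t1 : t <= 1 by rewrite ge_min lexx.
have tr : `|t *: h| < r.
  rewrite normrZ gtr0_norm//.
  apply: (@le_lt_trans _ _ (r / 2 / (`|h| + 1) * (`|h| + 1))).
    apply: ler_pM => //; first exact: ltW.
      by rewrite ge_min lexx orbT.
    by rewrite lerDl.
  by rewrite divfK ?gt_eqF// ltr_pdivrMr// ltr_pMr// ltr1n.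
have /fr : ball x r (x + t *: h).
  by rewrite -ball_normE /= opprD addNKr normrN.
rewrite [x + t *: h - x]addrC addKr => /=.
have := fO x y t Ox Oy; rewrite (ltW t0) t1 => /(_ isT) ht.
rewrite clin_scalev -/h normrZ gtr0_norm// /GRing.scale/= ler_norml => /andP[].
rewrite lerNl opprB lerBlDr.
have -> : e = d * (`|h| + 1) by rewrite divfK// gt_eqF.
move=> h2 _; have dh : t * df h <= t * (f y - f x + d * `|h|).
  by rewrite mulrDr mulrCA; lra.
rewrite ler_pM2l// in dh; lra.
Qed.

(** Convexity bounds an increment from both sides by gradients at different points. When these
    gradients are continuous and agree at [x], the bounds force differentiability there. *)
Lemma fderiv_squeeze (f : X -> R) x (A : clin X R) (a b : X -> clin X R) :
  {for x, continuous a} -> {for x, continuous b} -> a x = A -> b x = A ->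
  (\forall y \near x, b y (y - x) <= f y - f x <= a y (y - x)) ->
  fderiv x f A.
Proof.
move=> /cvgrPdist_le ac /cvgrPdist_le bc aA bA ab0 e e0; near=> y.
have ab : b y (y - x) <= f y - f x <= a y (y - x) by near: y.
have ay : `|A - a y| <= e by rewrite -aA; near: y; exact: ac.
have bY : `|A - b y| <= e by rewrite -bA; near: y; exact: bc.
have H (g : clin X R) : `|A - g| <= e -> `|A (y - x) - g (y - x)| <= e * `|y - x|.
  move=> ge; rewrite -clinB (le_trans (clin_le _ _))//.
  by rewrite ler_wpM2r.
have := H _ ay; have := H _ bY; move: ab.
rewrite !ler_norml; lra.
Unshelve. all: by end_near. Qed.

End Convex.



(** * A smooth convex ramp *)

Section Ramp.
Context {R : realType}.
Implicit Types (s t : R) (m n : nat).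

(** The powers of [s^-1] are carried along to make the family closed under differentiation up to
    linear combinations, see [dflat]. *)
Definition flat m s : R := if 0 < s then s^-1 ^+ m * expR (- s^-1) else 0.

(** The term of order [m.+2] of the exponential series at [s^-1] already beats the power. A
    quadratic bound is what makes the derivative at 0 vanish. *)
Lemma flat_le m s : `|flat m s| <= m.+2`!%:R * s ^+ 2.
Proof.
rewrite /flat; case: ltP => s0; last by rewrite normr0 mulr_ge0// sqr_ge0.
have u0 : 0 < s^-1 by rewrite invr_gt0.
rewrite ger0_norm ?mulr_ge0 ?exprn_ge0 ?expR_ge0 ?(ltW u0)//.
rewrite expRN ler_pdivrMr ?expR_gt0//.
have f0 : 0 < m.+2`!%:R :> R by rewrite ltr0n fact_gt0.
have h : s^-1 ^+ m.+2 / m.+2`!%:R <= expR s^-1.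
  by apply: le_trans (expR_ge1Dxn m.+1 (ltW u0)); rewrite lerDr.
apply: (@le_trans _ _ (m.+2`!%:R * s ^+ 2 * (s^-1 ^+ m.+2 / m.+2`!%:R))).
  rewrite le_eqVlt; apply/orP; left; apply/eqP.
  rewrite !exprVn -addn2 exprD; field.
  by rewrite addn2 expf_eq0 !(gt_eqF s0) andbF (gt_eqF f0).
by rewrite ler_wpM2l// mulr_ge0 ?sqr_ge0// ltW.
Qed.

Lemma is_derive_is_diff (f : R -> R) (x d : R) :
  is_derive x 1 f d -> is_diff x f (d *: clin_id R).
Proof.
move=> [/derivable1_diffP fd] fE; apply: DiffDef => //.
apply/funext => h; rewrite diff1E// derive1E fE.
by rewrite /= /GRing.scale/= mulrC.
Qed.

Definition dflat m s : R := flat m.+2 s - m%:R * flat m.+1 s.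

Lemma fderiv_flat m s : fderiv s (flat m) (dflat m s *: clin_id R).
Proof.
have [s0|s0|->] := ltrgtP s 0.
- have -> : dflat m s *: clin_id R = 0.
    by rewrite /dflat /flat ltNge (ltW s0)/= mulr0 subr0 scale0r.
  apply: fderiv_near (fderiv_cst 0 s).
  near=> t; rewrite /flat ltNge ltW//.
  by near: t; exact: lt_nbhsl.
- pose g t := t^-1 ^+ m * expR (- t^-1).
  have fg : \forall t \near s, g t = flat m t.
    near=> t; rewrite /flat ifT//.
    by near: t; exact: lt_nbhsr.
  apply: fderiv_near fg _; apply/is_diffE/is_derive_is_diff.
  have sn0 : s != 0 by rewrite gt_eqF.
  have dV : is_derive s 1 (fun t : R => t^-1) (- s ^- 2 *: 1) by exact: is_deriveV.
  have dE : is_derive s 1 (fun t : R => expR (- t^-1)) (expR (- s^-1) * - (- s ^- 2 *: 1)).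
    by apply: is_derive1_comp.
  have dM := is_deriveM (is_deriveX m dV) dE.
  have -> : g = (fun t => t^-1) ^+ m * (fun t => expR (- t^-1)).
    by apply/funext => t; rewrite /g !fctE.
  apply: (is_derive_eq dM); rewrite !fctE /dflat /flat s0 /GRing.scale/=.
  case: m {g dM} => [|k]; rewrite ?mul0r ?expr0 ?mulr1n /=.
    by field.
  rewrite -[in s ^- 2]exprVn; move: (s^-1) (expR _) => a E. rewrite !exprS. ring.
have -> : dflat m 0 *: clin_id R = 0.
  by rewrite /dflat /flat ltxx mulr0 subr0 scale0r.
move=> e e0; pose C : R := m.+2`!%:R.
have C0 : 0 < C by rewrite ltr0n fact_gt0.
near=> t.
rewrite [X in _ - X](_ : _ = 0)// !subr0 {2}/flat ltxx subr0.
rewrite (le_trans (flat_le _ _))// -/C -real_normK ?num_real// expr2 mulrA ler_wpM2r//.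
rewrite mulrC -ler_pdivlMr//.
near: t; apply/nbhs_ballP; exists (e / C) => /=; first by rewrite divr_gt0.
by move=> t; rewrite -ball_normE/= sub0r normrN => /ltW.
Unshelve. all: by end_near. Qed.

Lemma Cn_on_flat n m : Cn_on n setT (flat m).
Proof.
elim: n m => [|n IH] m.
  by move=> s _; exact: fderiv_continuous (@fderiv_flat m s).
exists (fun s => dflat m s *: clin_id R).
  by move=> s _; apply/is_diffE; exact: fderiv_flat.
apply: Cn_onZ; last exact: Cn_on_cst.
rewrite /dflat; apply: Cn_onD => //.
under eq_fun do rewrite -mulNr.
by apply: Cn_onM => //; exact: Cn_on_cst.
Qed.

(** The explicit function [s exp(-1/s)]: its slope [(1 + 1/s) exp(-1/s)] is at most 1 and it stays
    above [s - 1], both by [1 + u <= exp u]. *)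
Definition ramp s : R := s * flat 0 s.

Definition ramp_slope s : R := flat 0 s + flat 1 s.

Lemma Cn_on_ramp n : Cn_on n setT ramp.
Proof. by apply: Cn_onM; [exact: Cn_on_id|exact: Cn_on_flat]. Qed.

Lemma flat_ge0 m s : 0 <= flat m s.
Proof.
rewrite /flat; case: ltP => // s0.
by rewrite mulr_ge0 ?expR_ge0// exprn_ge0// invr_ge0 ltW.
Qed.

Lemma ramp_le0 s : s <= 0 -> ramp s = 0.
Proof. by rewrite /ramp /flat; case: ltP => //; rewrite mulr0. Qed.

Lemma ramp_gt0 s : 0 < s -> 0 < ramp s.
Proof. by move=> s0; rewrite /ramp /flat s0 expr0 mul1r mulr_gt0 ?expR_gt0. Qed.

Lemma ramp_ge0 s : 0 <= ramp s.
Proof. by case: (leP s 0) => [/ramp_le0->//|/ramp_gt0/ltW]. Qed.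

Lemma ramp_ge s : s - 1 <= ramp s.
Proof.
case: (leP s 0) => [s0|s0]; first by rewrite ramp_le0//; lra.
rewrite /ramp /flat s0 expr0 mul1r.
apply: (@le_trans _ _ (s * (1 + - s^-1))).
  by rewrite mulrDr mulr1 mulrN mulfV// gt_eqF.
by rewrite ler_pM2l// expR_ge1Dx.
Qed.

Lemma ramp_slope_ge0 s : 0 <= ramp_slope s.
Proof. by rewrite addr_ge0// flat_ge0. Qed.

Lemma ramp_slope_le1 s : ramp_slope s <= 1.
Proof.
rewrite /ramp_slope /flat; case: ltP => s0; last by rewrite addr0.
rewrite expr0 expr1 -mulrDl expRN ler_pdivrMr ?expR_gt0// mul1r.
exact: expR_ge1Dx.
Qed.

(** Convexity in the form of supporting lines, which avoids the second derivative. For positive [s]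
    and [t] it reduces to [1 + u <= exp u] with [u = 1/s - 1/t]. *)
Lemma ramp_tangent s t : ramp s + ramp_slope s * (t - s) <= ramp t.
Proof.
rewrite /ramp_slope.
case: (leP s 0) => [s0|s0].
  by rewrite ramp_le0// /flat ltNge s0/= addr0 mul0r addr0 ramp_ge0.
rewrite {1}/ramp /flat s0 expr0 expr1 mul1r.
set E := expR _; have E0 : 0 < E by exact: expR_gt0.
have -> : s * E + (E + s^-1 * E) * (t - s) = E * (t + t / s - 1).
  by field; rewrite gt_eqF.
case: (leP t 0) => [t0|t0].
  rewrite (le_trans _ (ramp_ge0 t))// pmulr_rle0//.
  have : t / s <= 0 by rewrite pmulr_lle0// invr_gt0.
  lra.
rewrite /ramp /flat t0 expr0 mul1r.
have -> : expR (- t^-1) = E * expR (s^-1 - t^-1) by rewrite -expRD; congr expR; ring.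
rewrite mulrCA ler_pM2l//.
apply: (@le_trans _ _ (t * (1 + (s^-1 - t^-1)))).
  by rewrite !mulrDr mulrN mulfV ?gt_eqF// mulr1; lra.
by rewrite ler_pM2l// expR_ge1Dx.
Qed.

Lemma ramp_mono s t : s <= t -> ramp s <= ramp t.
Proof.
move=> st; apply: le_trans (ramp_tangent s t).
by rewrite lerDl mulr_ge0 ?ramp_slope_ge0// subr_ge0.
Qed.

Lemma ramp_lip_le s t : s <= t -> ramp t - ramp s <= t - s.
Proof.
move=> st; have := ramp_tangent t s.
have : ramp_slope t * (t - s) <= t - s.
  by rewrite ler_piMl ?subr_ge0// ramp_slope_le1.
have -> : s - t = - (t - s) by ring.
rewrite mulrN; lra.
Qed.

End Ramp.



(** * Support functionals *)

Section SupportFunctional.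
Context {R : realType} {X : normedModType R}.

Definition sublinear (q : X -> R) :=
  (forall x y, q (x + y) <= q x + q y) /\
  (forall a x, 0 <= a -> q (a *: x) = a * q x).

Lemma sublinear0 q : sublinear q -> q 0 = 0.
Proof. by case=> _ /(_ 0 0 (lexx 0)); rewrite scale0r mul0r. Qed.

Lemma sublinear_geN q x : sublinear q -> - q (- x) <= q x.
Proof.
move=> sq; have := sq.1 x (- x); rewrite subrr sublinear0//; lra.
Qed.

(* Positive homogeneity only needs the inequality, by applying it to [a^-1]. *)
Lemma sublinearW q : (forall x y, q (x + y) <= q x + q y) -> q 0 = 0 ->
  (forall a x, 0 < a -> q (a *: x) <= a * q x) -> sublinear q.
Proof.
move=> qD q0 qZ; split=> // a x; rewrite le_eqVlt => /predU1P[<-|a0].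
  by rewrite scale0r mul0r.
apply/eqP; rewrite eq_le qZ//=.
have := qZ a^-1 (a *: x); rewrite invr_gt0 => /(_ a0).
by rewrite scalerA mulVf ?gt_eqF// scale1r ler_pdivlMl.
Qed.

(** The Hahn-Banach step: [r x] is the infimum of [q (x + t h) - t q h] over [t >= 0], and [t = 1]
    gives the value at [- h]. A minimal [q] coincides with its own [r], so it is odd and therefore
    linear. *)
Lemma sublinear_lower q h : sublinear q -> exists r, [/\ sublinear r,
  forall x, r x <= q x & r (- h) <= - q h].
Proof.
move=> sq; have [qD qZ] := sq.
pose A x := [set q (x + t *: h) - t * q h | t in [set t | 0 <= t]].
have A0 x : A x !=set0 by exists (q (x + 0 *: h) - 0 * q h); exists 0 => /=.
have lbA x : lbound (A x) (- q (- x)).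
  move=> _ [t /= t0 <-]; rewrite -qZ//.
  have := qD (x + t *: h) (- x); rewrite addrAC subrr add0r; lra.
have hA x : has_inf (A x) by split => //; exists (- q (- x)); exact: lbA.
have Ale x t : 0 <= t -> inf (A x) <= q (x + t *: h) - t * q h.
  by move=> t0; apply: ge_inf; [exact: (hA x).2|exists t].
exists (fun x => inf (A x)); split.
- apply: sublinearW => [x y||a x a0].
  + apply/ler_addgt0Pr => e e0; have e2 : 0 < e / 2 by rewrite divr_gt0.
    have [_ [t /= t0 <-] ht] := inf_adherent e2 (hA x).
    have [_ [s /= s0 <-] hs] := inf_adherent e2 (hA y).
    have := Ale (x + y) (t + s) (addr_ge0 t0 s0).
    have := qD (x + t *: h) (y + s *: h).
    by rewrite scalerDl addrACA mulrDl; lra.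
  + apply/eqP; rewrite eq_le; apply/andP; split.
      have := Ale 0 0 (lexx 0).
      by rewrite scale0r addr0 mul0r subr0 sublinear0.
    by apply: lb_le_inf => //; have := lbA 0; rewrite oppr0 sublinear0// oppr0.
  + rewrite -ler_pdivrMl//; apply: lb_le_inf => // _ [t /= t0 <-].
    rewrite ler_pdivrMl//.
    have := Ale (a *: x) (a * t); rewrite mulr_ge0 ?(ltW a0)// => /(_ isT).
    by rewrite -scalerA -scalerDr qZ ?(ltW a0)// -mulrA -mulrBr.
- by move=> x; have := Ale x 0 (lexx 0); rewrite scale0r addr0 mul0r subr0.
have := Ale (- h) 1 ler01.
by rewrite scale1r addNr mul1r sublinear0// sub0r.
Qed.

(** Zorn's lemma for the reversed pointwise order. Along a chain the infimum is finite, because a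
    sublinear [q] below [p] satisfies [- p (- x) <= q x], and it is subadditive, because the smaller
    of two members of the chain serves both summands. *)
Lemma sublinear_minimal p : sublinear p -> exists q, [/\ sublinear q,
  forall x, q x <= p x &
  forall r, sublinear r -> (forall x, r x <= q x) -> r = q].
Proof.
move=> sp; pose T := {q : X -> R | sublinear q /\ forall x, q x <= p x}.
pose le (q r : T) := `[< forall x, sval r x <= sval q x >].
have [||||q qmin] := @Zorn T le.
- by move=> q; apply/asboolP.
- move=> q r s /asboolP qr /asboolP rs; apply/asboolP => x.
  exact: le_trans (rs x) (qr x).
- move=> [q sq] [r sr] /asboolP/= qr /asboolP/= rq; apply: eq_exist => /=.
  by apply/funext => x; apply/eqP; rewrite eq_le qr rq.
- move=> A Atot; have [[q0 Aq0]|nA] := pselect (A !=set0); last first.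
    exists (exist _ p (conj sp (fun=> lexx _))) => s As.
    by case: nA; exists s.
  pose B x := [set sval q x | q in A].
  have lbB x : lbound (B x) (- p (- x)).
    move=> _ [[q [sq qp]] /= Aq <-].
    by apply: le_trans (sublinear_geN x sq); rewrite lerN2.
  have hB x : has_inf (B x).
    by split; [exists (sval q0 x); exists q0|exists (- p (- x)); exact: lbB].
  have Ble q x : A q -> inf (B x) <= sval q x.
    by move=> Aq; apply: ge_inf; [exact: (hB x).2|exists q].
  have sB : sublinear (fun x => inf (B x)).
    apply: sublinearW => [x y||a x a0].
    + apply/ler_addgt0Pr => e e0; have e2 : 0 < e / 2 by rewrite divr_gt0.
      have [_ [q Aq <-] hq] := inf_adherent e2 (hB x).
      have [_ [r Ar <-] hr] := inf_adherent e2 (hB y).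
      have [s [As sq sr]] : exists s, [/\ A s, sval s x <= sval q x
          & sval s y <= sval r y].
        have [/asboolP h|/asboolP h] := Atot _ _ Aq Ar.
          by exists r.
        by exists q.
      have := Ble s (x + y) As; have := (svalP s).1.1 x y; lra.
    + rewrite (_ : B 0 = [set 0]) ?inf1//; apply/seteqP; split=> y /=.
        by move=> [q Aq <-]; exact: sublinear0 (svalP q).1.
      by move=> ->; exists q0 => //; exact: sublinear0 (svalP q0).1.
    + rewrite -ler_pdivrMl//; apply: lb_le_inf => //; first exact: (hB x).1.
      move=> _ [q Aq <-]; rewrite ler_pdivrMl// -(svalP q).1.2 ?(ltW a0)//.
      exact: Ble.
  have Bp x : inf (B x) <= p x by apply: le_trans (Ble _ x Aq0) ((svalP q0).2 x).
  pose b : T := exist (fun q => sublinear q /\ forall x, q x <= p x)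
    (fun x => inf (B x)) (conj sB Bp).
  exists b => s As; apply/asboolP => x /=; exact: Ble.
exists (sval q); split; [exact: (svalP q).1|exact: (svalP q).2|].
move=> r sr rq; have rp x : r x <= p x by apply: le_trans (rq x) ((svalP q).2 x).
pose b : T := exist (fun q => sublinear q /\ forall x, q x <= p x) r (conj sr rp).
by rewrite -(qmin b)//; apply/asboolP.
Qed.

(** Lowering [p] along [x] before minimizing forces every functional below it to take a value at
    most [- p x] at [- x]; a minimal one is linear, so it reaches [p x] at [x]. *)
Lemma support_functional p x K : sublinear p -> (forall y, p y <= K * `|y|) ->
  exists2 f : clin X R, (forall y, f y <= p y) & f x = p x.
Proof.
move=> sp pK; have [r [sr rp rx]] := sublinear_lower x sp.
have [q [sq qr qmin]] := sublinear_minimal sr.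
have qN h : q (- h) = - q h.
  apply/eqP; rewrite eq_le; apply/andP; split.
    have [s [ss sqq sh]] := sublinear_lower h sq.
    by rewrite -{1}(qmin _ ss sqq).
  by rewrite lerNl; exact: sublinear_geN.
have qD y z : q (y + z) = q y + q z.
  apply/eqP; rewrite eq_le sq.1/= -lerN2 -qN !opprD -!qN; exact: sq.1.
have qZ a y : q (a *: y) = a * q y.
  have [a0|a0] := leP 0 a; first exact: sq.2.
  by rewrite -[in LHS](opprK a) scaleNr qN sq.2 ?oppr_ge0 ?(ltW a0)// mulNr opprK.
have lq : linear q by move=> a y z; rewrite qD qZ.
have qp y : q y <= p y by exact: le_trans (qr y) (rp y).
have bq : exists M, forall y, `|q y| <= M * `|y|.
  exists K => y; rewrite ler_norml lerNl -qN.
  by rewrite (le_trans (qp y) (pK y)) -(normrN y) (le_trans (qp _) (pK _)).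
exists (clin_of lq bq) => //=; apply/eqP; rewrite eq_le qp/= -lerN2 -qN.
exact: le_trans (qr _) rx.
Qed.

End SupportFunctional.



(** * Separability of the dual *)

Section Ekeland.
Context {R : realType} {X : completeNormedModType R}.

(** [S x] is the set of points below [x] in Ekeland's order. Each [x_ k.+1] nearly minimizes [u] on
    [S (x_ k)], so the nested sets [S (x_ k)] shrink to the limit, below which only the limit itself
    remains. *)
Lemma ekeland (u : X -> R) m tau : continuous u -> (forall x, m <= u x) ->
  0 < tau -> exists x, forall y, u x - tau * `|y - x| <= u y.
Proof.
move=> uc um tau0; pose S x := [set y | u y + tau * `|y - x| <= u x].
have Sxx x : S x x by rewrite /S /= subrr normr0 mulr0 addr0.
have Strans x y z : S x y -> S y z -> S x z.
  rewrite /S /= => xy yz.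
  have : `|z - x| <= `|z - y| + `|y - x| by rewrite (le_trans _ (ler_normD _ _))// addrA subrK.
  by rewrite -(ler_pM2l tau0) mulrDr; lra.
pose uS x := [set u y | y in S x].
have huS x : has_inf (uS x).
  by split; [exists (u x), x|exists m => _ [y _ <-]].
have /choice[nxt hnxt] (xk : X * nat) : exists y, S xk.1 y /\
    forall z, S xk.1 z -> u y - xk.2.+1%:R^-1 <= u z.
  have e0 : 0 < xk.2.+1%:R^-1 :> R by rewrite invr_gt0.
  have [_ [y Sy <-] hy] := inf_adherent e0 (huS xk.1).
  exists y; split => // z Sz; have : inf (uS xk.1) <= u z.
    by apply: ge_inf; [exact: (huS _).2|exists z].
  by move=> h; rewrite lerBlDr (le_trans (ltW hy))// lerD2r.
pose x_ := fix x_ k := if k is k'.+1 then nxt (x_ k', k') else 0.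
have xS k l : (k <= l)%N -> S (x_ k) (x_ l).
  elim: l => [|l IH]; first by rewrite leqn0 => /eqP->.
  rewrite leq_eqVlt => /predU1P[->//|]; rewrite ltnS => /IH h.
  exact: Strans h (hnxt (x_ l, l)).1.
have small k y : S (x_ k.+1) y -> tau * `|y - x_ k.+1| <= k.+1%:R^-1.
  move=> Sy; have /= := (hnxt (x_ k, k)).2 y (Strans _ _ _ (hnxt (x_ k, k)).1 Sy).
  by move: Sy; rewrite /S /=; move: (k.+1%:R^-1) => c; lra.
have smallk e : 0 < e -> exists k, forall y, S (x_ k) y -> `|y - x_ k| < e.
  move=> e0; have te : 0 < tau * e by rewrite mulr_gt0.
  have [k] : exists k, k.+1%:R^-1 < tau * e by have [k] := ltr_add_invr te; rewrite add0r; exists k.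
  move=> hk; exists k.+1 => y /small hy; rewrite -(ltr_pM2l tau0).
  exact: le_lt_trans hy hk.
have /cvg_ex[x xx] : cvgn x_.
  apply: cauchy_cvg; apply: cauchy_exP => e e0.
  have [k hk] := smallk e e0; exists (x_ k); exists k => // l /= kl.
  by rewrite -ball_normE /= distrC; apply: hk; exact: xS.
have Sx k : S (x_ k) x.
  have c1 : u (x_ l) @[l --> \oo] --> u x by exact: (cvg_comp _ _ xx (uc x)).
  have c2 : tau * `|x_ l - x_ k| @[l --> \oo] --> tau * `|x - x_ k|.
    by apply: cvgMl_tmp; apply: cvg_norm; apply: cvgB => //; exact: cvg_cst.
  rewrite /S /=; apply: (cvgr_to_le (cvgD c1 c2)).
  by exists k => // l /= kl; exact: xS.
exists x => y; rewrite leNgt; apply/negP => hy.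
have Sy k : S (x_ k) y by apply: Strans (Sx k) _; rewrite /S /=; lra.
suff yx : y = x by move: hy; rewrite yx subrr normr0 mulr0 subr0 ltxx.
apply/eqP; rewrite -subr_eq0 -normr_le0; apply/ler_addgt0Pr => e e0; rewrite add0r.
have e2 : 0 < e / 2 by rewrite divr_gt0.
have [k hk] := smallk _ e2.
rewrite -(subrKA (x_ k)) (le_trans (ler_normD _ _))// [leRHS]splitr.
by rewrite lerD ?ltW// ?hk// distrC hk.
Qed.

End Ekeland.

Section DualSeparable.
Context {R : realType} {X : completeNormedModType R}.

(** A one-sided bound is enough: applied to [h] and to [- h], it bounds the linear [A] on both
    sides. *)
Lemma fderiv_norm_le (u : X -> R) x (A : clin X R) c : 0 <= c -> fderiv x u A ->
  (\forall y \near x, u x - c * `|y - x| <= u y) -> `|A| <= c.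
Proof.
move=> c0 uA ux.
have H e h : 0 < e -> - (c + e) * `|h| <= A h.
  move=> e0; have /nbhs_ballP[r /= r0 hr] : \forall y \near x,
      `|u y - u x - A (y - x)| <= e * `|y - x| /\ u x - c * `|y - x| <= u y.
    exact: filterI (uA _ e0) ux.
  have h1 : 0 < `|h| + 1 by rewrite ltr_wpDl.
  pose t := r / 2 / (`|h| + 1).
  have t0 : 0 < t by rewrite !divr_gt0.
  have : ball x r (x + t *: h).
    rewrite -ball_normE /= opprD addNKr normrN normrZ gtr0_norm//.
    apply: (@le_lt_trans _ _ (t * (`|h| + 1))).
      by rewrite ler_wpM2l ?(ltW t0)// lerDl.
    by rewrite divfK ?gt_eqF// ltr_pdivrMr// ltr_pMr// ltr1n.
  move=> /hr[]; rewrite [x + t *: h - x]addrC addKr normrZ gtr0_norm//.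
  rewrite clin_scalev /GRing.scale/= ler_norml => /andP[_].
  move=> h1' h2; rewrite -(ler_pM2l t0); nra.
have {}H h : - c * `|h| <= A h.
  apply/ler_addgt0Pr => e e0.
  have h1 : 0 < `|h| + 1 by rewrite ltr_wpDl.
  have := H (e / (`|h| + 1)) h (divr_gt0 e0 h1).
  have : e / (`|h| + 1) * `|h| <= e by rewrite mulrAC ler_pdivrMr// ler_pM2l// lerDl.
  by rewrite mulNr mulrDl; lra.
apply: clin_norm_le => // h; rewrite ler_norml -mulNr H/= -lerN2 -mulNr.
by rewrite -(normrN h) (le_trans (H _))// linearN.
Qed.

Lemma separable_seq (T : normedModType R) : separable T ->
  exists e : nat -> T, forall x d, 0 < d -> exists i, `|x - e i| < d.
Proof.
move=> [D /countable_injP[f finj] Dd].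
have /choice[e he] n : exists y, forall x, D x -> f x = n -> y = x.
  have [[y [Dy fy]]|ny] := pselect (exists y, D y /\ f y = n).
    by exists y => x Dx fx; apply: finj; rewrite ?inE// fx.
  by exists 0 => x Dx fx; case: ny; exists x.
exists e => x d d0.
have [y [/= By Dy]] : ball x d `&` D !=set0.
  by apply: Dd; [exists x; exact: ballxx|exact: ball_open].
by exists (f y); rewrite (he _ y)//; move: By; rewrite -ball_normE.
Qed.

(* By Ekeland's principle applied to [|x|^2/2 - f], the functionals
   [|x| *: d|.|(x)] are dense in the dual. *)
Lemma dual_separable (N : X -> clin X R) : separable X ->
  (forall x, x != 0 -> fderiv x (fun y => `|y|) (N x)) ->
  (forall x, x != 0 -> {for x, continuous N}) ->
  exists g : nat -> clin X R, forall f d, 0 < d -> exists j, `|f - g j| < d.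
Proof.
move=> /separable_seq[e de] dN cN.
pose G (x : X) : clin X R := `|x| *: N x.
pose g n := if n is k.+1 then G (e k) else 0.
exists g => f d d0.
have [fd|df] := ltP `|f| d; first by exists 0%N; rewrite subr0.
have d2 : 0 < d / 2 by rewrite divr_gt0.
pose u x := `|x| ^+ 2 / 2 - f x.
have uc : continuous u.
  move=> x; apply: cvgB; last exact: clin_continuous.
  by apply: cvgMr_tmp; rewrite expr2; apply: cvgM; exact: norm_continuous.
have um x : - `|f| ^+ 2 / 2 <= u x.
  have := clin_le f x; rewrite ler_norml => /andP[_ h].
  have := sqr_ge0 (`|f| - `|x|); rewrite /u; nra.
have [x hx] := ekeland uc um d2.
(* The norm has to be differentiable at the Ekeland point. At 0 the inequality along [t *: z] with
   small [t] would give [|f| <= d / 2], the case already served by [g 0 = 0]. *)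
have x0 : x != 0.
  apply/eqP => x0; move: df; rewrite leNgt => /negP; apply.
  suff : `|f| <= d / 2 by lra.
  apply: clin_norm_le => [|y]; first exact: ltW.
  have H (z : X) : f z <= d / 2 * `|z|.
    apply/ler_addgt0Pr => c c0.
    pose t := c / (`|z| ^+ 2 + c + 1).
    have D0 : 0 < `|z| ^+ 2 + c + 1 by have := sqr_ge0 `|z|; lra.
    have t0 : 0 < t by rewrite divr_gt0.
    have := hx (t *: z); rewrite x0 /u normr0 linear0 subr0 expr0n/= mul0r subr0.
    rewrite clin_scalev normrZ gtr0_norm// /GRing.scale/= exprMn => h.
    have tz : t * `|z| ^+ 2 <= c.
      rewrite /t mulrAC ler_pdivrMr//.
      by have := sqr_ge0 `|z|; nra.
    rewrite -(ler_pM2l t0); nra.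
  rewrite ler_norml H andbT lerNl -linearN -(normrN y); exact: H.
have fu : `|G x - f| <= d / 2.
  have d1 := fderiv_bibounded (@scaler_bibounded R R) (dN x x0) (dN x x0).
  have d3 := fderivD (fderiv_comp d1 (fderiv_clin (2^-1 *: clin_id R) _))
    (fderiv_clin (- f) x).
  have d4 : fderiv x u (G x - f).
    apply: fderiv_near (fderiv_eq d3 _).
      apply: nearW => y; rewrite /u /= /GRing.scale/= expr2.
      by rewrite [_ *: _]mulrC.
    move=> h.
    have E : 2^-1 * (N x h * `|x| + `|x| * N x h) = `|x| * N x h.
      by move: (N x h) `|x| => a b; field.
    by rewrite !clinB; congr (_ - _); exact: E.
  by apply: (fderiv_norm_le (ltW d2) d4); apply: nearW => y.
have /cvgrPdist_lt Gc : {for x, continuous G}.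
  apply: cvgZ; [exact: norm_continuous|exact: cN].
have /nbhs_ballP[r /= r0 Gr] := Gc _ d2.
have [i ir] := de x r r0.
exists i.+1; rewrite /= -(subrKA (G x)) (le_lt_trans (ler_normD _ _))//.
rewrite [ltRHS]splitr ler_ltD//; first by rewrite distrC.
by apply: Gr; rewrite -ball_normE.
Qed.
End DualSeparable.



(** * Penalized distances to finite-dimensional subspaces *)

Section InfConvolution.
Context {R : realType} {X : normedModType R}.

Lemma convex_comb_shift (x y e : X) (t a b : R) :
  x + t *: (y - x) - (a + t * (b - a)) *: e =
  (x - a *: e) + t *: ((y - b *: e) - (x - a *: e)).
Proof.
rewrite scalerDl opprD addrACA -scalerA -scalerBr; congr (_ + _ *: _).
by rewrite scalerBl !opprB addrACA [in RHS]addrACA [- x - _]addrC.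
Qed.

Definition lip1 (f : X -> R) := forall x y, f y - f x <= `|y - x|.

Lemma lip1_continuous f : lip1 f -> continuous f.
Proof.
move=> fl x; apply/cvgrPdist_le => e e0; near=> y.
have yx : `|x - y| <= e by rewrite distrC; near: y; exact: nbhs_dist_le.
by rewrite ler_norml (le_trans (fl _ _))// andbT lerNl opprB (le_trans (fl _ _))// distrC.
Unshelve. all: by end_near. Qed.

Lemma fderiv_dir_ge (u : X -> R) x (A : clin X R) h c eta : fderiv x u A ->
  (forall r, 0 < r -> u x + r * c - eta * r ^+ 2 <= u (x + r *: h)) -> c <= A h.
Proof.
move=> uA ur; apply/ler_addgt0Pr => e e0.
have h1 : 0 < `|h| + 1 by rewrite ltr_wpDl.
have eh0 : 0 < e / 2 / (`|h| + 1) by rewrite !divr_gt0.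
have /nbhs_ballP[r /= r0 hr] := uA _ eh0.
pose k := `|eta| + 1; have k0 : 0 < k by rewrite ltr_wpDl.
pose t := Num.min (r / 2 / (`|h| + 1)) (e / 2 / k).
have t0 : 0 < t by rewrite lt_min !divr_gt0.
have : ball x r (x + t *: h).
  rewrite -ball_normE /= opprD addNKr normrN normrZ gtr0_norm//.
  apply: (@le_lt_trans _ _ (r / 2 / (`|h| + 1) * (`|h| + 1))).
    apply: ler_pM => //; first exact: ltW.
      by rewrite ge_min lexx.
    by rewrite lerDl.
  by rewrite divfK ?gt_eqF// ltr_pdivrMr// ltr_pMr// ltr1n.
move=> /hr; rewrite [x + t *: h - x]addrC addKr normrZ gtr0_norm//.
rewrite clin_scaleR ler_norml => /andP[_] h2.
have h3 := ur t t0.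
have h4 : e / 2 / (`|h| + 1) * (t * `|h|) <= t * (e / 2).
  rewrite mulrCA ler_wpM2l ?(ltW t0)// mulrAC ler_pdivrMr// ler_wpM2l//.
    by rewrite divr_ge0// ltW.
  by rewrite lerDl.
have h5 : eta * t ^+ 2 <= t * (e / 2).
  rewrite expr2 mulrA mulrC ler_wpM2l ?(ltW t0)//.
  apply: (@le_trans _ _ (k * t)).
    by rewrite ler_wpM2r ?(ltW t0)// (le_trans (ler_norm _))// lerDl.
  by rewrite mulrC -ler_pdivlMr// ge_min lexx orbT.
rewrite -(ler_pM2l t0); lra.
Qed.

Lemma infconv_exists (f : X -> R) e eta x : 0 < eta -> (forall y, 0 <= f y) ->
  lip1 f -> exists t : R, forall s, f (x - t *: e) + eta * t ^+ 2 <=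
    f (x - s *: e) + eta * s ^+ 2.
Proof.
move=> eta0 f0 fl; pose g s := f (x - s *: e) + eta * s ^+ 2.
(* Beyond [M] the penalty alone exceeds [f x], the value at [t = 0]: as [M >= 1], there
   [s ^+ 2 >= M], and [eta * M >= f x]. So a minimum over the compact interval is global. *)
pose M := f x / eta + 1; have M1 : 1 <= M by rewrite lerDr divr_ge0// ltW.
have gc : {within `[- M, M], continuous g}.
  have gs : continuous g.
    move=> s; have c1 : f (x - s' *: e) @[s' --> s] --> f (x - s *: e).
      apply: (@cvg_comp _ _ _ (fun s' : R => x - s' *: e) f _ (nbhs (x - s *: e))).
        by apply: cvgB; [exact: cvg_cst|apply: cvgZr_tmp; exact: cvg_id].
      exact: (@lip1_continuous f fl (x - s *: e)).
    have c2 : eta * s' ^+ 2 @[s' --> s] --> eta * s ^+ 2.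
      by apply: cvgMl_tmp; rewrite expr2; apply: cvgM; exact: cvg_id.
    exact: cvgD c1 c2.
  exact: continuous_subspaceT gs.
have M0 : 0 <= M by exact: le_trans ler01 M1.
have MM : - M <= M by rewrite ge0_cp.
have [t _ ht] := EVT_min MM gc; exists t => s; rewrite -!/(g _).
have [sM|sM] := leP `|s| M; first by apply: ht; rewrite in_itv /= -ler_norml.
apply: (@le_trans _ _ (g 0)); first by apply: ht; rewrite in_itv /= oppr_le0 M0.
rewrite /g scale0r subr0 expr0n/= mulr0 addr0.
apply: (@le_trans _ _ (eta * s ^+ 2)); last by rewrite lerDr.
rewrite -real_normK ?num_real//.
apply: (@le_trans _ _ (eta * M)).
  by rewrite /M mulrDr mulrCA mulfV ?gt_eqF// !mulr1 lerDl ltW.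
rewrite ler_pM2l// (le_trans (ltW sM))// expr2 ler_peMl//.
exact: le_trans M1 (ltW sM).
Qed.

Section Minimizer.
Context (f : X -> R) (e : X) (eta : R) (eta0 : 0 < eta)
  (f0 : forall x, 0 <= f x) (fl : lip1 f) (fconv : convex_on setT f).

Definition argmin x := projT1 (cid (infconv_exists e x eta0 f0 fl)).
Definition proj_argmin x := x - argmin x *: e.
Definition infconv x := f (proj_argmin x) + eta * argmin x ^+ 2.

Lemma infconv_le x s : infconv x <= f (x - s *: e) + eta * s ^+ 2.
Proof. by rewrite /infconv /proj_argmin /argmin; case: cid => t /= ->. Qed.

Lemma infconv_ge0 x : 0 <= infconv x.
Proof. by rewrite addr_ge0// mulr_ge0 ?sqr_ge0// ltW. Qed.

Lemma infconv_le_self x : infconv x <= f x.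
Proof. by have := infconv_le x 0; rewrite scale0r subr0 expr0n/= mulr0 addr0. Qed.

Lemma infconv_lip1 : lip1 infconv.
Proof.
move=> x y; rewrite lerBlDr (le_trans (infconv_le y (argmin x)))//.
rewrite /infconv addrA lerD2r -lerBlDr (le_trans (fl _ _))//.
by rewrite /proj_argmin opprB addrA subrK.
Qed.

Lemma infconv_even : (forall x, f (- x) = f x) ->
  forall x, infconv (- x) = infconv x.
Proof.
move=> fN; have H x : infconv (- x) <= infconv x.
  rewrite (le_trans (infconv_le _ (- argmin x)))// sqrrN scaleNr opprK.
  by rewrite -fN opprD opprK.
by move=> x; apply/eqP; rewrite eq_le H -{1}(opprK x) H.
Qed.

Lemma infconv_convex : convex_on setT infconv.
Proof.
move=> x y t _ _ t01; set z := x + _.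
pose s := argmin x + t * (argmin y - argmin x).
rewrite (le_trans (infconv_le z s))//.
have -> : z - s *: e = proj_argmin x + t *: (proj_argmin y - proj_argmin x).
  exact: convex_comb_shift.
have := fconv (x := proj_argmin x) (y := proj_argmin y) I I t01.
rewrite /infconv /s.
have t2 : 0 <= t * (1 - t) by case/andP: t01 => *; rewrite mulr_ge0// subr_ge0.
have : eta * (argmin x + t * (argmin y - argmin x)) ^+ 2 <=
    eta * argmin x ^+ 2 + t * (eta * argmin y ^+ 2 - eta * argmin x ^+ 2).
  move: (argmin x) (argmin y) => a b.
  have -> : eta * a ^+ 2 + t * (eta * b ^+ 2 - eta * a ^+ 2) =
    eta * (a + t * (b - a)) ^+ 2 + eta * (t * (1 - t) * (b - a) ^+ 2) by ring.
  by rewrite lerDl mulr_ge0 ?(ltW eta0)// mulr_ge0 ?sqr_ge0.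
lra.
Qed.

(** At the midpoint of the two minimizers the penalty gains a quarter of [eta] times their squared
    distance, while exchanging [x] and [y] costs [|y - x|] twice by the Lipschitz bound, halved by
    convexity. This continuity starts the bootstrap. *)
Lemma argmin_dist x y : (argmin y - argmin x) ^+ 2 <= 4 / eta * `|y - x|.
Proof.
rewrite mulrAC ler_pdivlMr//.
pose s := argmin x + 2^-1 * (argmin y - argmin x).
have h1 := infconv_le x s.
have E : x - s *: e = proj_argmin x + 2^-1 *: ((x - argmin y *: e) - proj_argmin x).
  by rewrite /proj_argmin -convex_comb_shift subrr scaler0 addr0.
have h2 : f (x - s *: e) <= f (proj_argmin x) + 2^-1 * (f (x - argmin y *: e) - f (proj_argmin x)).
  by rewrite E; apply: fconv => //; apply/andP; split; lra.
have h3 := infconv_le y (argmin x).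
have h4 : f (x - argmin y *: e) - f (proj_argmin y) <= `|y - x|.
  by rewrite (le_trans (fl _ _))// /proj_argmin opprB addrA subrK distrC.
have h5 : f (y - argmin x *: e) - f (proj_argmin x) <= `|y - x|.
  by rewrite (le_trans (fl _ _))// /proj_argmin opprB addrA subrK.
move: h1 h2 h3; rewrite /infconv /s; nra.
Qed.

Lemma argmin_continuous : continuous argmin.
Proof.
move=> x; apply/cvgrPdist_le => d d0.
have c0 : 0 < d ^+ 2 * eta / 4 by rewrite divr_gt0// mulr_gt0// exprn_gt0.
near=> y; rewrite distrC -ler_sqr ?nnegrE// ?(ltW d0)// real_normK ?num_real//.
have h : `|y - x| <= d ^+ 2 * eta / 4 by near: y; exact: nbhs_dist_le.
rewrite (le_trans (argmin_dist x y))// mulrAC ler_pdivrMr//.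
by move: h; rewrite ler_pdivlMr// mulrC.
Unshelve. all: by end_near. Qed.

Lemma Cn_on_proj_argmin n : Cn_on n setT argmin -> Cn_on n setT proj_argmin.
Proof.
move=> tn; apply: Cn_onD; first exact: Cn_on_id.
under eq_fun do rewrite -scaleN1r.
by apply: Cn_on_scale; apply: Cn_onZ => //; exact: Cn_on_cst.
Qed.

Lemma proj_argmin_continuous : continuous proj_argmin.
Proof.
by move=> x; apply: (@Cn_on_proj_argmin 0) => // y _; exact: argmin_continuous.
Qed.

Section Gradient.
Context (df : X -> clin X R) (fd : forall x, fderiv x f (df x)).

Lemma argmin_stationary x : df (proj_argmin x) e = 2 * eta * argmin x.
Proof.
have key r : f (proj_argmin x) + r * (2 * eta * argmin x) - eta * r ^+ 2 <=
    f (proj_argmin x + r *: e).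
  have := infconv_le x (argmin x - r); rewrite /infconv scalerBl opprB addrA addrAC.
  by rewrite -/(proj_argmin x); lra.
apply/eqP; rewrite eq_le; apply/andP; split; last first.
  by apply: (fderiv_dir_ge (fd _)) => r _; exact: key.
rewrite -lerN2 -linearN; apply: (fderiv_dir_ge (fd _)) => r _.
by rewrite mulrN -mulNr scalerN -scaleNr -(sqrrN r).
Qed.

(** The envelope theorem. Testing each minimum with the other minimizer encloses the increment
    between gradients of [f] at [x - argmin y *: e] and [y - argmin x *: e]; only continuity of
    [argmin] is used. *)
Lemma fderiv_infconv (dfc : continuous df) x :
  fderiv x infconv (df (proj_argmin x)).
Proof.
have fle y z : f y + df y (z - y) <= f z by exact: fderiv_convex_le fconv I I (fd y).
apply: (@fderiv_squeeze _ _ infconv x _ (fun y => df (y - argmin x *: e))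
  (fun y => df (x - argmin y *: e))) => //.
- apply: continuous_comp; last exact: dfc.
  by apply: cvgB; [exact: cvg_id|exact: cvg_cst].
- apply: continuous_comp; last exact: dfc.
  apply: cvgB; first exact: cvg_cst.
  by apply: cvgZr_tmp; exact: argmin_continuous.
apply: nearW => y; apply/andP; split.
  have := infconv_le x (argmin y); have := fle (x - argmin y *: e) (proj_argmin y).
  rewrite {2}/proj_argmin opprB addrA subrK {2}/infconv; lra.
have := infconv_le y (argmin x); have := fle (y - argmin x *: e) (proj_argmin x).
have -> : proj_argmin x - (y - argmin x *: e) = - (y - x).
  by rewrite /proj_argmin opprB addrA subrK opprB.
rewrite linearN [infconv x]/infconv; lra.
Qed.

Context (d2f : X -> clin X (clin X R)) (dfd : forall x, fderiv x df (d2f x)).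

(** The derivative in [t] of [2 * eta * t - df (x - t *: e) e], which vanishes at [t = argmin x],
    taken where [x - t *: e = z]. *)
Definition argmin_denom z : R := 2 * eta + d2f z e e.

(** Adding the tangent inequalities at [z] and [z + r *: e] shows that [df] is monotone along [e],
    so the second derivative of [f] contributes a nonnegative term; strict positivity comes from the
    penalty. *)
Lemma argmin_denom_gt0 z : 0 < argmin_denom z.
Proof.
apply: ltr_wpDr; last by rewrite mulr_gt0.
have d1 : fderiv z (fun y => df y e) (clin_comp (clin_ev R e) (d2f z)).
  exact: (fderiv_comp (dfd z) (fderiv_clin (clin_ev R e) _)).
apply: (fderiv_dir_ge (eta := 0) (h := e) d1) => r r0.
rewrite mulr0 addr0 mul0r subr0.
have h1 := fderiv_convex_le (x := z) (y := z + r *: e) fconv I I (fd z).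
have h2 := fderiv_convex_le (x := z + r *: e) (y := z) fconv I I (fd _).
have E1 : z + r *: e - z = r *: e by rewrite addrC addKr.
have E2 : z - (z + r *: e) = - (r *: e) by rewrite -opprB E1.
rewrite -(ler_pM2l r0); move: h1 h2.
by rewrite E1 E2 clin_oppv !clin_scaleR; lra.
Qed.

Definition dargmin z : clin X R :=
  (argmin_denom z)^-1 *: clin_comp (clin_ev R e) (d2f z).

(** Implicit differentiation by hand: subtract the stationarity equations at [x] and [y] and
    linearize [df _ e] at [z]. This is legitimate because [proj_argmin y] is already known to tend
    to [z]. *)
Lemma fderiv_argmin x : fderiv x argmin (dargmin (proj_argmin x)).
Proof.
set z := proj_argmin x; set D := argmin_denom z.
have D0 : 0 < D := argmin_denom_gt0 z.
pose G : clin X R := clin_comp (clin_ev R e) (d2f z).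
have gd : fderiv z (fun y => df y e) G.
  exact: (fderiv_comp (dfd z) (fderiv_clin (clin_ev R e) _)).
move=> e0 e00.
pose K := `|G| / D + 1.
have K0 : 0 < K by rewrite ltr_wpDl// divr_ge0// ltW.
(* [d] is small enough for the error to absorb the occurrence of the increment
   of [argmin] itself in the remainder. *)
pose d := Num.min (D / 2 / (`|e| + 1)) (e0 * D / 2 / (1 + K * `|e|)).
have e1 : 0 < `|e| + 1 by rewrite ltr_wpDl.
have K1 : 0 < 1 + K * `|e| by rewrite ltr_pwDl// mulr_ge0// ltW.
have d0 : 0 < d by rewrite lt_min !divr_gt0// mulr_gt0.
have near1 := proj_argmin_continuous (gd d d0).
near=> y.
have hz : `|df (proj_argmin y) e - df z e - G (proj_argmin y - z)| <=
    d * `|proj_argmin y - z| by near: y; exact: near1.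
rewrite !argmin_stationary in hz.
pose dt := argmin y - argmin x.
have zE : proj_argmin y - z = (y - x) - dt *: e.
  by rewrite /z /proj_argmin /dt scalerBl !opprB addrACA [RHS]addrACA [- x + _]addrC.
have GE : G (proj_argmin y - z) = G (y - x) - dt * (D - 2 * eta).
  rewrite zE clin_subv clin_scaleR; congr (_ - _ * _).
  by rewrite /D /argmin_denom addrC addKr.
have {}hz : `|D * dt - G (y - x)| <= d * (`|y - x| + `|dt| * `|e|).
  have -> : D * dt - G (y - x) = 2 * eta * argmin y - 2 * eta * argmin x
      - G (proj_argmin y - z) by rewrite GE /dt; ring.
  rewrite (le_trans hz)// ler_wpM2l ?(ltW d0)// zE.
  by rewrite (le_trans (ler_normB _ _))// normrZ.
rewrite clinZ -/G [_ *: _]/(D^-1 * G (y - x)) -/dt.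
set E := dt - _.
have EE : D * E = D * dt - G (y - x) by rewrite /E mulrBr mulVKf// gt_eqF.
rewrite -EE normrM gtr0_norm// in hz.
have dtE : `|dt| <= `|E| + `|G| / D * `|y - x|.
  rewrite -(subrK (D^-1 * G (y - x)) dt) (le_trans (ler_normD _ _))// lerD2l.
  rewrite normrM gtr0_norm ?invr_gt0// mulrC mulrAC ler_wpM2r ?invr_ge0 ?(ltW D0)//.
  exact: clin_le.
have da : d * (`|e| + 1) <= D / 2 by rewrite -ler_pdivlMr// ge_min lexx.
have db : d * (1 + K * `|e|) <= e0 * D / 2.
  by rewrite -ler_pdivlMr// ge_min lexx orbT.
have nE := normr_ge0 E; have ne := normr_ge0 e; have nyx := normr_ge0 (y - x).
rewrite -(ler_pM2l D0).
have s1 : d * (`|dt| * `|e|) <= d * ((`|E| + K * `|y - x|) * `|e|).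
  rewrite ler_wpM2l ?(ltW d0)// ler_wpM2r// (le_trans dtE)// lerD2l.
  by rewrite ler_wpM2r// lerDl.
have s2 : d * `|e| * `|E| <= D / 2 * `|E|.
  by rewrite ler_wpM2r// (le_trans _ da)// ler_wpM2l ?(ltW d0)// lerDl.
have s3 : d * (1 + K * `|e|) * `|y - x| <= e0 * D / 2 * `|y - x|.
  by rewrite ler_wpM2r.
lra.
Unshelve. all: by end_near. Qed.

End Gradient.

(** The gradient is [df] composed with [proj_argmin], so order [n] suffices for [argmin]. That order
    is bootstrapped, as [dargmin] at [proj_argmin x] is an expression in [d2f] and [argmin]. *)
Lemma Cn_on_infconv n : Cn_on n.+1 setT f -> Cn_on n.+1 setT infconv.
Proof.
move=> [df fd dfn]; have fd' x : fderiv x f (df x) by apply/is_diffE; exact: fd.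
have dfc : continuous df by move=> x; exact: Cn_onSn_continuous dfn x I.
exists (fun x => df (proj_argmin x)).
  by move=> x _; apply/is_diffE; exact: fderiv_infconv.
apply: (Cn_on_comp (V := setT)) => //; apply: Cn_on_proj_argmin.
case: n dfn => [|n] dfn; first by move=> x _; exact: argmin_continuous.
have [d2f dfd d2fn] := dfn.
have dfd' x : fderiv x df (d2f x) by apply/is_diffE; exact: dfd.
apply: (@Cn_on_bootstrap _ _ _ _ _ _ (fun x => dargmin d2f (proj_argmin x))).
- by move=> x _; exact: argmin_continuous.
- by move=> x _; apply/is_diffE; exact: fderiv_argmin.
move=> m mn tm; apply: (Cn_on_comp (V := setT)) => //.
  exact: Cn_on_proj_argmin.
have evn : Cn_on m setT (fun z => clin_comp (clin_ev R e) (d2f z)).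
  apply: (Cn_on_bibounded (B := @clin_comp R X (clin X R) R)) => //.
  - exact: clin_comp_bibounded.
  - exact: Cn_on_cst.
  - exact: Cn_on_leq d2fn.
apply: Cn_onZ => //; apply: Cn_onV.
  by move=> z _; rewrite gt_eqF// (argmin_denom_gt0 fd').
apply: Cn_onD; first exact: Cn_on_cst.
apply: (Cn_on_comp (V := setT) _ evn (g := fun a : clin X R => a e)) => //.
exact: (Cn_on_clin _ _ (clin_ev R e)).
Qed.

End Minimizer.
End InfConvolution.



(** * Ramps of convex functions, and convexity of sums and norms *)

Section ConvexTools.
Context {R : realType} {X : normedModType R}.
Implicit Types (O : set X) (f g : X -> R).

Lemma ramp_convex (s u t : R) : 0 <= t <= 1 ->
  ramp (s + t * (u - s)) <= ramp s + t * (ramp u - ramp s).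
Proof.
move=> /andP[t0 t1]; set m := s + _.
have h1 := ramp_tangent m s; have h2 := ramp_tangent m u.
have h3 : (1 - t) * (ramp m + ramp_slope m * (s - m)) <= (1 - t) * ramp s.
  by rewrite ler_wpM2l// subr_ge0.
have h4 : t * (ramp m + ramp_slope m * (u - m)) <= t * ramp u.
  by rewrite ler_wpM2l.
have : (1 - t) * (ramp m + ramp_slope m * (s - m)) +
  t * (ramp m + ramp_slope m * (u - m)) = ramp m by rewrite /m; ring.
lra.
Qed.

Lemma convex_onD O f g : convex_on O f -> convex_on O g ->
  convex_on O (fun x => f x + g x).
Proof.
move=> fO gO x y t Ox Oy t01.
by have := fO x y t Ox Oy t01; have := gO x y t Ox Oy t01; lra.
Qed.

Lemma convex_onZ O f (a : R) : 0 <= a -> convex_on O f ->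
  convex_on O (fun x => a * f x).
Proof.
move=> a0 fO x y t Ox Oy t01.
have -> : a * f x + t * (a * f y - a * f x) = a * (f x + t * (f y - f x)) by ring.
by rewrite ler_wpM2l// fO.
Qed.

Lemma convex_on_ramp O f (A c : R) : 0 <= A -> convex_on O f ->
  convex_on O (fun x => A * ramp (f x + c)).
Proof.
move=> A0 fO; apply: convex_onZ => // x y t Ox Oy t01.
rewrite (le_trans _ (ramp_convex _ _ t01))// ramp_mono//.
have -> : f x + c + t * (f y + c - (f x + c)) = f x + t * (f y - f x) + c by ring.
by rewrite lerD2r fO.
Qed.

Lemma convex_on_clin O (h : clin X R) : convex_on O h.
Proof. by move=> x y t _ _ _; rewrite clin_addv clin_scaleR clin_subv. Qed.

Lemma convex_on_sum O I (s : seq I) (f : I -> X -> R) :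
  (forall i, convex_on O (f i)) -> convex_on O (fun x => \sum_(i <- s) f i x).
Proof.
move=> fO; elim: s => [|i s IH].
  by move=> x y t _ _ _; rewrite !big_nil subrr mulr0 addr0.
move=> x y t Ox Oy t01; rewrite !big_cons.
exact: (convex_onD (fO i) IH).
Qed.

Lemma convex_on_norm : convex_on setT (fun x : X => `|x|).
Proof.
move=> x y t _ _ /andP[t0 t1].
have -> : x + t *: (y - x) = (1 - t) *: x + t *: y.
  by rewrite scalerBl scale1r scalerBr addrA addrAC.
rewrite (le_trans (ler_normD _ _))// !normrZ !ger0_norm ?subr_ge0//; lra.
Qed.

Lemma ramp_lip (s t : R) : ramp t - ramp s <= `|t - s|.
Proof.
case: (leP s t) => st; first by rewrite ger0_norm ?subr_ge0// ramp_lip_le.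
by rewrite (@le_trans _ _ 0)// subr_le0 ramp_mono// ltW.
Qed.

Lemma Cn_on_ramp_comp n (U : set X) f (A c : R) : Cn_on n U f ->
  Cn_on n U (fun x => A * ramp (f x + c)).
Proof.
move=> fn; apply: Cn_onM; first exact: Cn_on_cst.
apply: (Cn_on_comp (V := setT) _ _ (g := @ramp R)) => //; last exact: Cn_on_ramp.
by apply: Cn_onD => //; exact: Cn_on_cst.
Qed.

End ConvexTools.

Lemma open_setC0 {R : realType} {X : normedModType R} : open (~` [set (0 : X)]).
Proof.
apply: closed_openC; apply: accessible_closed_set1; apply: hausdorff_accessible.
exact: norm_hausdorff.
Qed.

(** * Smooth substitutes for the distance to a finite-dimensional subspace *)

Section SmoothedDistance.
Context {R : realType} {X : normedModType R}.

Record distlike (d : X -> R) : Prop := Distlike {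
  distlike_ge0 : forall x, 0 <= d x ;
  distlike_lip : lip1 d ;
  distlike_convex : convex_on setT d ;
  distlike_even : forall x, d (- x) = d x
}.

(** It vanishes on the ball of radius [eps], where the norm has its singularity; the outer factor
    [eps] restores the Lipschitz constant 1. *)
Definition flat_norm (eps : R) (x : X) : R := eps * ramp (eps^-1 * `|x| - 1).

Lemma flat_norm_distlike eps : 0 < eps -> distlike (flat_norm eps).
Proof.
move=> e0; split.
- by move=> x; rewrite mulr_ge0 ?ramp_ge0// ltW.
- move=> x y; rewrite /flat_norm -mulrBr.
  apply: (@le_trans _ _ (eps * (eps^-1 * `| `|y| - `|x| |))).
    rewrite ler_pM2l// (le_trans (ramp_lip _ _))// opprD addrACA subrr addr0.
    by rewrite -mulrBr normrM gtr0_norm ?invr_gt0.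
  by rewrite mulVKf ?gt_eqF// ler_dist_dist.
- apply: convex_on_ramp; first exact: ltW.
  by apply: convex_onZ; [rewrite invr_ge0 ltW|exact: convex_on_norm].
- by move=> x; rewrite /flat_norm normrN.
Qed.

Lemma flat_norm0 eps x : 0 < eps -> `|x| <= eps -> flat_norm eps x = 0.
Proof.
move=> e0 xe; rewrite /flat_norm ramp_le0 ?mulr0//.
by rewrite subr_le0 ler_pdivrMl// mulr1.
Qed.

Lemma flat_norm_ge eps x : 0 < eps -> `|x| - 2 * eps <= flat_norm eps x.
Proof.
move=> e0; apply: (@le_trans _ _ (eps * (eps^-1 * `|x| - 1 - 1))).
  by rewrite !mulrDr mulVKf ?gt_eqF//; lra.
by rewrite ler_pM2l// ramp_ge.
Qed.

Lemma Cn_on_flat_norm eps n : 0 < eps ->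
  Cn_on n (~` [set 0]) (fun x : X => `|x|) -> Cn_on n setT (flat_norm eps).
Proof.
move=> e0 nn; apply: Cn_on_local => x _.
have [->|x0] := eqVneq x 0.
  exists (ball 0 eps); split; [exact: ball_open|exact: ballxx|].
  apply: (Cn_on_congr (f := fun=> 0)); [exact: ball_open| |exact: Cn_on_cst].
  by move=> y; rewrite -ball_normE /= sub0r normrN => /ltW yx; rewrite flat_norm0.
exists (~` [set 0]); split; [exact: open_setC0|exact/eqP|].
by apply: Cn_on_ramp_comp; apply: Cn_onM => //; exact: Cn_on_cst.
Qed.

(* The bound on [h x] is [h x <= delta * dist(x, span es)] up to errors; the
   quadratic penalty of the infimal convolutions pays for [h] not vanishing
   exactly on [es]. *)
Lemma smoothed_distance (eps : R) (es : seq X) : 0 < eps -> exists d : X -> R,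
  [/\ distlike d, d 0 = 0,
    forall n, Cn_on n.+1 (~` [set 0]) (fun x : X => `|x|) -> Cn_on n.+1 setT d,
    forall x e, e \in es -> d x <= `|x - e| + eps &
    forall delta gamma (h : clin X R) x, 0 < delta -> `|h| <= delta ->
      (forall e, e \in es -> `|h e| <= gamma) ->
      h x <= delta * d x + 2 * delta * eps
        + (size es)%:R * (gamma ^+ 2 / (4 * delta * eps))].
Proof.
move=> e0; elim: es => [|e es [d [dd d0 dn de dh]]].
  exists (flat_norm eps); split => //.
  - exact: flat_norm_distlike.
  - by rewrite flat_norm0// normr0 ltW.
  - by move=> n; exact: Cn_on_flat_norm.
  move=> delta gamma h x delta0 hd _; rewrite mul0r addr0.
  have h1 : h x <= delta * `|x|.
    rewrite (le_trans (ler_norm _))// (le_trans (clin_le _ _))//.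
    by rewrite ler_wpM2r.
  have h2 : delta * (`|x| - 2 * eps) <= delta * flat_norm eps x.
    by rewrite ler_pM2l// flat_norm_ge.
  lra.
have d0' := distlike_ge0 dd; have dl := distlike_lip dd.
have dc := distlike_convex dd.
exists (infconv e e0 d0' dl); split.
- split; [exact: infconv_ge0|exact: infconv_lip1|exact: infconv_convex|].
  exact: infconv_even (distlike_even dd).
- by apply/eqP; rewrite eq_le infconv_ge0 andbT (le_trans (infconv_le_self _ _ _ _ _))// d0.
- by move=> n /dn; exact: Cn_on_infconv.
- move=> x y; rewrite inE => /predU1P[->|ye]; last first.
    by rewrite (le_trans (infconv_le_self _ _ _ _ _))// de.
  (* The competitor [t = 1] moves [x] to [x - e] at the price of a penalty [eps]. *)
  rewrite (le_trans (infconv_le _ _ _ _ x 1))// scale1r expr1n mulr1 lerD2r.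
  by have := dl 0 (x - e); rewrite d0 !subr0.
move=> delta gamma h x delta0 hd he.
pose t := argmin e e0 d0' dl x.
have := dh delta gamma h (x - t *: e) delta0 hd.
have hes y : y \in es -> `|h y| <= gamma by move=> ye; apply: he; rewrite inE ye orbT.
move=> /(_ hes); rewrite clin_subv clin_scaleR => h1.
have h2 : t * h e <= `|t| * gamma.
  rewrite (le_trans (ler_norm _))// normrM ler_wpM2l// he// inE eqxx//.
(* Young's inequality, weighted so that the square in [t] is exactly [delta] times the penalty
   contained in [infconv]. The remainder is the contribution of [e] to the last term of the
   bound. *)
have h3 : `|t| * gamma <= delta * eps * t ^+ 2 + gamma ^+ 2 / (4 * delta * eps).
  have c0 : 0 < 4 * delta * eps by rewrite !mulr_gt0.
  rewrite -(ler_pM2l c0) mulrDr mulrCA [_ * (_ / _)]mulrC divfK ?gt_eqF//.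
  have := sqr_ge0 (2 * delta * eps * `|t| - gamma).
  rewrite -[t ^+ 2]real_normK ?num_real//; nra.
rewrite /infconv -/t /proj_argmin -/t /= -[(size es).+1]addn1 natrD; lra.
Qed.

End SmoothedDistance.



(** * Finite nets of functionals *)

Section FiniteNets.
Context {R : realType} {X : normedModType R}.

Lemma grid_cell (M : nat) (r gamma : R) : 0 <= r -> r <= M.+1%:R * gamma ->
  exists2 i, (i < M.+1)%N & i%:R * gamma <= r <= i.+1%:R * gamma.
Proof.
move=> r0; elim: M => [|M IH] rM; first by exists 0%N; rewrite // mul0r r0.
have [/IH[i iM hi]|/ltW h] := leP r (M.+1%:R * gamma).
  by exists i => //; exact: ltnW.
by exists M.+1 => //; rewrite h rM.
Qed.

(** The net has to consist of members of [A], so no approximants are built: the range of [f e] is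
    cut into cells of length [gamma], and the induction runs separately on the part of [A] in each
    cell. *)
Lemma finite_net (A : set (clin X R)) K gamma (es : seq X) : 0 < gamma ->
  (forall f e, A f -> `|f e| <= K * `|e|) ->
  exists s : seq (clin X R), (forall f, f \in s -> A f) /\
    forall f, A f -> exists2 f', f' \in s &
      forall e, e \in es -> `|f e - f' e| <= gamma.
Proof.
move=> gamma0; elim: es A => [|e es IH] A AK.
  have [[a Aa]|nA] := pselect (A !=set0).
    exists [:: a]; split=> [f|f Af]; first by rewrite inE => /eqP->.
    by exists a; rewrite ?inE.
  by exists [::]; split => // f Af; case: nA; exists f.
pose B := K * `|e|.
pose M := Num.truncn (2 * B / gamma).
have BM r : `|r| <= B -> 0 <= r + B /\ r + B <= M.+1%:R * gamma.
  move=> rB; move: (rB); rewrite ler_norml => /andP[r1 r2]; split; first by lra.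
  have B0 : 0 <= B by apply: le_trans rB.
  rewrite -ler_pdivrMr// (@le_trans _ _ (2 * B / gamma))//.
    by rewrite ler_pM2r ?invr_gt0//; lra.
  by rewrite ltW// truncnS_gt// divr_ge0// ?mulr_ge0// ltW.
pose cell (i : nat) := [set f | A f /\ i%:R * gamma <= f e + B <= i.+1%:R * gamma].
have /choice[s hs] i := IH (cell i) (fun f e' Af => AK f e' Af.1).
exists (flatten [seq s i | i <- iota 0 M.+1]); split.
  by move=> f /flatten_mapP[i _ /(hs i).1[]].
move=> f Af; have [h1 h2] := BM (f e) (AK f e Af).
have [i iM hi] := grid_cell h1 h2.
have [f' f's f'es] := (hs i).2 f (conj Af hi).
exists f'; first by apply/flatten_mapP; exists i; rewrite ?mem_iota.
move=> y; rewrite inE => /predU1P[->|]; last exact: f'es.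
have [_ hi'] := (hs i).1 f' f's.
move: hi hi' => /andP[a1 a2] /andP[b1 b2].
have E : i.+1%:R * gamma = i%:R * gamma + gamma by rewrite -addn1 natrD mulrDl mul1r.
rewrite E in a2 b2; rewrite ler_norml; apply/andP; split; lra.
Qed.

(** [F n] unites nets for the balls of radius [tau] about [g 0], ..., [g n.-1]. Norm closeness comes
    from lying in a common ball, closeness on the points [e i] from the net. *)
Lemma functional_nets (p : X -> R) K (e : nat -> X) (g : nat -> clin X R) tau
    (gamma : nat -> R) :
  (forall y, p y <= K * `|y|) -> (forall n, 0 < gamma n) ->
  exists F : nat -> seq (clin X R),
    (forall n f, f \in F n -> forall y, f y <= p y) /\
    forall (f : clin X R) j n, (forall y, f y <= p y) -> `|f - g j| <= tau ->
      (j < n)%N -> exists2 f', f' \in F n &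
      `|f - f'| <= 2 * tau /\
      forall y, y \in mkseq e n -> `|(f - f') y| <= gamma n.
Proof.
move=> pK gamma0.
pose A j := [set f : clin X R | (forall y, f y <= p y) /\ `|f - g j| <= tau].
have AK j f y : A j f -> `|f y| <= K * `|y|.
  move=> [fp _]; rewrite ler_norml (le_trans (fp y) (pK y)) andbT lerNl -clin_oppv.
  by rewrite (le_trans (fp _))// -(normrN y).
have /choice[s hs] (jn : nat * nat) :=
  finite_net (mkseq e jn.2) (gamma0 jn.2) (AK jn.1).
exists (fun n => flatten [seq s (j, n) | j <- iota 0 n]); split.
  by move=> n f /flatten_mapP[j _ /(hs (j, n)).1[]].
move=> f j n fp fg jn; have [f' f's hf'] := (hs (j, n)).2 f (conj fp fg).
exists f'; first by apply/flatten_mapP; exists j; rewrite ?mem_iota.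
split; last by move=> y /hf'; rewrite clinB.
rewrite -(subrKA (g j)) (le_trans (ler_normD _ _))// mulr_natl mulr2n lerD//.
by have [_] := (hs (j, n)).1 f' f's; rewrite distrC.
Qed.

End FiniteNets.



(** * The norm whose unit sphere is a level set *)

Section Gauge.
Context {R : realType} {X : normedModType R}.

Lemma is_norm0 (q : X -> R) : is_norm q -> q 0 = 0.
Proof. by case=> _ /(_ 0 0) + _; rewrite scale0r normr0 mul0r. Qed.

Lemma is_normN (q : X -> R) x : is_norm q -> q (- x) = q x.
Proof. by case=> _ qZ _; rewrite -scaleN1r qZ normrN1 mul1r. Qed.

Lemma is_norm_ge0 (q : X -> R) x : is_norm q -> 0 <= q x.
Proof.
move=> qn; have [qD _ _] := qn; have := qD x (- x).
by rewrite subrr is_norm0// is_normN//; lra.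
Qed.

Lemma is_norm_gt0 (q : X -> R) x : is_norm q -> x != 0 -> 0 < q x.
Proof.
move=> qn x0; rewrite lt_neqAle is_norm_ge0// andbT eq_sym.
by apply: contra x0 => /eqP; case: qn => _ _ q0 /q0 ->.
Qed.

Lemma is_norm_sub (q : X -> R) x y : is_norm q -> q y - q x <= q (y - x).
Proof. by case=> qD _ _; rewrite lerBlDr -{1}(subrK x y) qD. Qed.

Lemma is_norm_continuous (q : X -> R) C : is_norm q ->
  (forall x, q x <= C * `|x|) -> continuous q.
Proof.
move=> qn qC x; apply/cvgrPdist_le => d d0.
have C0 : 0 < `|C| + 1 by rewrite ltr_wpDl.
have dC : 0 < d / (`|C| + 1) by rewrite divr_gt0.
near=> y.
have h : `|y - x| <= d / (`|C| + 1) by near: y; exact: nbhs_dist_le.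
apply: (@le_trans _ _ (q (y - x))).
  rewrite ler_norml lerNl opprB is_norm_sub// -(is_normN (y - x))// opprB.
  exact: is_norm_sub.
apply: (le_trans (qC _)); apply: (@le_trans _ _ ((`|C| + 1) * `|y - x|)).
  by rewrite ler_wpM2r// (le_trans (ler_norm _))// lerDl.
by rewrite mulrC -ler_pdivlMr.
Unshelve. all: by end_near. Qed.

Context (p : X -> R) (pn : is_norm p) (K : R) (pK : forall x, p x <= K * `|x|).
Context (Phi : X -> R) (rho : R) (rho01 : 0 < rho < 1).
Let O := [set x | p x < 1].
Context (Phi_convex : convex_on O Phi) (Phi_even : forall x, Phi (- x) = Phi x)
  (Phi_cont : forall x, O x -> {for x, continuous Phi})
  (Phi0 : forall x, p x <= rho -> Phi x = 0)
  (Phi1 : forall x, p x = 1 -> exists2 t, 0 < t < 1 & 1 < Phi (t *: x)).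

(** The condition [p x < r] places [r^-1 *: x] in [O], the only region where Phi is controlled. *)
Definition gauge_at x r := [/\ 0 < r, p x < r & Phi (r^-1 *: x) = 1].

Lemma normalized_in x r : 0 < r -> p x < r -> O (r^-1 *: x).
Proof.
move=> r0 px; have [_ pZ _] := pn.
by rewrite /O /= pZ gtr0_norm ?invr_gt0// ltr_pdivrMl// mulr1.
Qed.

Lemma gauge_exists x : x != 0 -> exists r, gauge_at x r.
Proof.
move=> x0; have px := is_norm_gt0 pn x0; have [_ pZ _] := pn.
pose u := (p x)^-1 *: x.
have pu : p u = 1 by rewrite /u pZ gtr0_norm ?invr_gt0// mulVf// gt_eqF.
have [t /andP[t0 t1] ht] := Phi1 pu.
have c : {within `[0, t], continuous (fun s : R => Phi (s *: u))}.
  apply: continuous_in_subspaceT => s; rewrite inE /= in_itv/= => /andP[s0 st].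
  apply: (@continuous_comp _ _ _ (fun s : R => s *: u) Phi).
    by apply: cvgZr_tmp; exact: cvg_id.
  by apply: Phi_cont; rewrite /O /= pZ pu ger0_norm// mulr1 (le_lt_trans st).
have cond : Num.min (Phi (0 *: u)) (Phi (t *: u)) <= 1 <=
    Num.max (Phi (0 *: u)) (Phi (t *: u)).
  rewrite scale0r Phi0 ?is_norm0 ?(ltW (andP rho01).1)//.
  by rewrite ge_min le_max ler01 (ltW ht) orbT.
have [s] := IVT (ltW t0) c cond; rewrite in_itv/= => /andP[s0 st] Ps.
have sn0 : 0 < s.
  rewrite lt_neqAle s0 andbT; apply/eqP => s00; move: Ps.
  rewrite -s00 scale0r Phi0 ?is_norm0 ?(ltW (andP rho01).1)// => /eqP.
  by rewrite eq_sym oner_eq0.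
exists (p x / s); split.
- by rewrite divr_gt0.
- by rewrite ltr_pdivlMr// gtr_pMr// (le_lt_trans st).
by rewrite invfM invrK mulrC -scalerA.
Qed.

Definition gauge x : R :=
  if pselect (x != 0) is left x0 then projT1 (cid (gauge_exists x0)) else 0.

Lemma gaugeP x : x != 0 -> gauge_at x (gauge x).
Proof.
move=> x0; rewrite /gauge; case: pselect => // x0'; by case: cid.
Qed.

Lemma gauge0 : gauge 0 = 0.
Proof. by rewrite /gauge; case: pselect => // x0; have /eqP := x0. Qed.

(** On a ray Phi is convex and 0 at the origin, so [r < gauge x] would give Phi a value at most
    [r / gauge x < 1] at [(gauge x)^-1 *: x]. Thus the chosen root is the least admissible [r], from
    which the norm axioms follow. *)
Lemma gauge_le x r : p x < r -> Phi (r^-1 *: x) <= 1 -> gauge x <= r.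
Proof.
move=> pxr Pr.
have r0 : 0 < r by apply: le_lt_trans pxr; exact: is_norm_ge0.
have [->|x0] := eqVneq x 0; first by rewrite gauge0 ltW.
have [g0 pg Pg] := gaugeP x0.
rewrite leNgt; apply/negP => rg.
have t01 : 0 <= r / gauge x <= 1.
  by rewrite divr_ge0 ?(ltW r0) ?(ltW g0)//= ler_pdivrMr// mul1r ltW.
have O0 : O 0 by rewrite /O /= is_norm0.
have := Phi_convex O0 (normalized_in r0 pxr) t01.
rewrite add0r subr0 scalerA mulrAC mulfV ?gt_eqF// mul1r Pg.
rewrite Phi0 ?is_norm0 ?(ltW (andP rho01).1)// add0r subr0.
have : r / gauge x * Phi (r^-1 *: x) <= r / gauge x.
  by rewrite ler_piMr//; case/andP: t01.
have : r / gauge x < 1 by rewrite ltr_pdivrMr// mul1r.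
lra.
Qed.

Lemma gauge_ge x : p x <= gauge x.
Proof.
have [->|x0] := eqVneq x 0; first by rewrite gauge0 is_norm0.
by have [_ /ltW] := gaugeP x0.
Qed.

Lemma gauge_le_norm x : gauge x <= rho^-1 * p x.
Proof.
have [->|x0] := eqVneq x 0; first by rewrite gauge0 is_norm0// mulr0.
have /andP[r0 r1] := rho01; have px := is_norm_gt0 pn x0; have [_ pZ _] := pn.
apply: gauge_le; first by rewrite ltr_pMl// invf_gt1.
rewrite Phi0// pZ gtr0_norm ?invr_gt0 ?mulr_gt0 ?invr_gt0//.
by rewrite invfM invrK divfK// gt_eqF.
Qed.

Lemma gauge_scale_le a x : a != 0 -> gauge (a *: x) <= `|a| * gauge x.
Proof.
move=> a0; have [->|x0] := eqVneq x 0; first by rewrite scaler0 gauge0 mulr0.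
have [g0 pg Pg] := gaugeP x0; have [_ pZ _] := pn.
have na0 : 0 < `|a| by rewrite normr_gt0.
apply: gauge_le; first by rewrite pZ ltr_pM2l.
rewrite scalerA invfM mulrAC.
have [ap|an|/eqP] := ltgtP 0 a; last by rewrite eq_sym (negPf a0).
  by rewrite gtr0_norm// mulVf ?mul1r ?Pg// gt_eqF.
by rewrite ltr0_norm// invrN mulNr mulVf ?mulN1r// ?scaleNr ?Phi_even ?Pg// lt_eqF.
Qed.

Lemma gauge_norm : is_norm gauge.
Proof.
split=> [x y|a x|x].
- have [->|x0] := eqVneq x 0; first by rewrite add0r gauge0 add0r.
  have [->|y0] := eqVneq y 0; first by rewrite addr0 gauge0 addr0.
  have [gx px Px] := gaugeP x0; have [gy py Py] := gaugeP y0.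
  have [pD _ _] := pn; set r := gauge x + gauge y.
  have r0 : 0 < r by rewrite addr_gt0.
  apply: gauge_le; first by rewrite (le_lt_trans (pD _ _))// ltrD.
  have t01 : 0 <= gauge y / r <= 1.
    rewrite divr_ge0 ?(ltW gy) ?(ltW r0)//= ler_pdivrMr// mul1r.
    by rewrite lerDr ltW.
  have := Phi_convex (normalized_in gx px) (normalized_in gy py) t01.
  rewrite Px Py subrr mulr0 addr0; congr (Phi _ <= _).
  rewrite [(gauge y / r) *: _]scalerBr !scalerA.
  have -> : gauge y / r / gauge y = r^-1 by rewrite mulrAC mulfV ?gt_eqF// mul1r.
  have E : (gauge x)^-1 - gauge y / r / gauge x = r^-1.
    by rewrite /r; field; rewrite !gt_eqF.
  by rewrite addrCA -scalerBl E scalerDr addrC.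
- have [->|a0] := eqVneq a 0; first by rewrite scale0r gauge0 normr0 mul0r.
  apply/eqP; rewrite eq_le gauge_scale_le//=.
  rewrite -ler_pdivlMl ?normr_gt0// -normfV.
  have {1}-> : x = a^-1 *: (a *: x) by rewrite scalerA mulVf// scale1r.
  by rewrite gauge_scale_le// invr_eq0.
move=> g0; have [_ _ p0] := pn; apply: p0; apply/eqP.
by rewrite eq_le -{1}g0 gauge_ge is_norm_ge0.
Qed.

Lemma gauge_continuous : continuous gauge.
Proof.
apply: (is_norm_continuous gauge_norm (C := rho^-1 * K)) => x.
have /andP[r0 r1] := rho01.
by rewrite (le_trans (gauge_le_norm x))// -mulrA ler_pM2l// invr_gt0.
Qed.

Definition normalize x : X := (gauge x)^-1 *: x.

Lemma Cn_on_normalize n : Cn_on n (~` [set 0]) gauge ->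
  Cn_on n (~` [set 0]) normalize.
Proof.
move=> gn; apply: Cn_onZ; last exact: Cn_on_id.
by apply: Cn_onV => // x /eqP x0; rewrite gt_eqF//; have [] := gaugeP x0.
Qed.

Section GaugeGradient.
Context (dPhi : X -> clin X R) (Phid : forall x, O x -> fderiv x Phi (dPhi x)).

(** The tangent at [z], evaluated at the origin, lies below [Phi 0 = 0]. This is the transversality
    that the implicit function argument needs. *)
Lemma dPhi_ge1 z : O z -> Phi z = 1 -> 1 <= dPhi z z.
Proof.
move=> Oz Pz; have O0 : O 0 by rewrite /O /= is_norm0.
have := fderiv_convex_le Phi_convex Oz O0 (Phid Oz).
rewrite sub0r clin_oppv Pz Phi0 ?is_norm0 ?(ltW (andP rho01).1)//; lra.
Qed.

(** What implicit differentiation of [Phi ((gauge x)^-1 *: x) = 1] gives at [z = normalize x]. *)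
Definition dgauge z : clin X R := (dPhi z z)^-1 *: dPhi z.

Lemma normalizeP x : x != 0 -> O (normalize x) /\ Phi (normalize x) = 1.
Proof.
by move=> x0; have [g0 pg Pg] := gaugeP x0; split => //; exact: normalized_in.
Qed.

Lemma Cn_on_dgauge n : Cn_on n O dPhi -> Cn_on n (~` [set 0]) gauge ->
  Cn_on n (~` [set 0]) (fun x => dgauge (normalize x)).
Proof.
move=> dn gn.
have zn := Cn_on_normalize gn.
have dzn : Cn_on n (~` [set 0]) (fun x => dPhi (normalize x)).
  by apply: (Cn_on_comp (V := O)) => // x /eqP/normalizeP[].
apply: Cn_onZ => //; apply: Cn_onV.
  move=> x /eqP/normalizeP[Oz Pz]; rewrite gt_eqF//.
  exact: lt_le_trans ltr01 (dPhi_ge1 Oz Pz).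
apply: (Cn_on_bibounded (B := fun (a : clin X R) (x : X) => a x)) => //.
split=> [y t a b|a t y z|] //; first by rewrite clin_addv clin_scalev.
by exists 1 => // a x; rewrite mul1r; exact: clin_le.
Qed.

(** Both normalized points lie on [Phi = 1], so the derivative at the first is nonpositive on their
    difference. Multiplied by [gauge y], this is the subgradient inequality for the gauge, ready for
    [fderiv_squeeze]. *)
Lemma gauge_gradient x y : x != 0 -> y != 0 ->
  dgauge (normalize x) (y - x) <= gauge y - gauge x.
Proof.
move=> x0 y0; have [Ox Px] := normalizeP x0; have [Oy Py] := normalizeP y0.
have [gy _ _] := gaugeP y0; have [gx _ _] := gaugeP x0.
have d1 := dPhi_ge1 Ox Px.
have := fderiv_convex_le Phi_convex Ox Oy (Phid Ox).
rewrite Px Py gerDl -(pmulr_rle0 _ gy) -clin_scaleR.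
have -> : gauge y *: (normalize y - normalize x) =
    (y - x) - (gauge y - gauge x) *: normalize x.
  rewrite scalerBr [gauge y *: normalize y]scalerA mulfV ?gt_eqF// scale1r.
  by rewrite scalerBl [gauge x *: normalize x]scalerA mulfV ?gt_eqF// scale1r
    opprB addrA subrK.
rewrite clin_subv clin_scaleR subr_le0 => h.
have d0 : 0 < dPhi (normalize x) (normalize x) by exact: lt_le_trans d1.
by rewrite [X in X <= _](_ : _ = (dPhi (normalize x) (normalize x))^-1 *
  dPhi (normalize x) (y - x))// ler_pdivrMl// mulrC.
Qed.

Lemma fderiv_gauge (dPhic : forall x, O x -> {for x, continuous dPhi}) x :
  x != 0 -> fderiv x gauge (dgauge (normalize x)).
Proof.
move=> x0; apply: (@fderiv_squeeze _ _ gauge x _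
  (fun y => dgauge (normalize y)) (fun=> dgauge (normalize x))) => //.
- apply: (@Cn_on_dgauge 0) => //; last exact/eqP.
  by move=> y _; exact: gauge_continuous.
- exact: cvg_cst.
have : \forall y \near x, (~` [set (0 : X)]) y.
  by apply: open_nbhs_nbhs; split; [exact: open_setC0|exact/eqP].
apply: filterS => y /eqP y0; rewrite gauge_gradient//=.
have := gauge_gradient y0 x0.
by rewrite -[x - y]opprB clin_oppv; lra.
Qed.

End GaugeGradient.

Lemma Cn_on_gauge n : Cn_on n.+1 O Phi -> Cn_on n.+1 (~` [set 0]) gauge.
Proof.
move=> [dPhi dP dn]; have dP' x : O x -> fderiv x Phi (dPhi x).
  by move=> Ox; apply/is_diffE; exact: dP.
have dc := Cn_onSn_continuous dn.
apply: (@Cn_on_bootstrap _ _ _ _ _ _ (fun x => dgauge dPhi (normalize x))).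
- by move=> x _; exact: gauge_continuous.
- by move=> x /eqP x0; apply/is_diffE; exact: fderiv_gauge.
by move=> m mn gm; apply: Cn_on_dgauge => //; exact: Cn_on_leq dn.
Qed.

End Gauge.



(** * Locally finite sums of caps *)

Section LocallyFiniteSum.
Context {R : realType} {X : normedModType R} (T : nat -> X -> R).

Definition vanishes_from N x := forall n, (N <= n)%N -> T n x = 0.

(** The default 0 where the sum does not terminate keeps the function total and even on all of
    [X]. *)
Definition lfsum x : R :=
  if pselect (exists N, vanishes_from N x) is left H
  then \sum_(n < projT1 (cid H)) T n x else 0.

Lemma vanishes_from_sum N M x : vanishes_from N x -> (N <= M)%N ->
  \sum_(n < M) T n x = \sum_(n < N) T n x.
Proof.
move=> vN NM; rewrite -(subnKC NM) big_split_ord /= [X in _ + X]big1 ?addr0//.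
by move=> i _; rewrite vN// leq_addr.
Qed.

Lemma lfsumE N x : vanishes_from N x -> lfsum x = \sum_(n < N) T n x.
Proof.
move=> vN; rewrite /lfsum; case: pselect => [H|[]]; last by exists N.
case: cid => M /= vM.
rewrite -(vanishes_from_sum vM (leq_maxl M N)).
exact: vanishes_from_sum vN (leq_maxr M N).
Qed.

Lemma vanishes_fromW N M x : (N <= M)%N -> vanishes_from N x -> vanishes_from M x.
Proof. by move=> NM vN n Mn; apply: vN; exact: leq_trans NM Mn. Qed.

Context (O : set X).
Hypothesis Tlf : forall x, O x -> exists N, \forall y \near x, vanishes_from N y.

Lemma lfsum_near x : O x ->
  exists N, \forall y \near x, \sum_(n < N) T n y = lfsum y.
Proof.
by move=> /Tlf[N hN]; exists N; apply: filterS hN => y /lfsumE->.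
Qed.

Lemma lfsum_vanishes x : O x -> exists N, vanishes_from N x.
Proof. by move=> /Tlf[N hN]; exists N; exact: nbhs_singleton hN. Qed.

Lemma Cn_on_lfsum m : (forall n, Cn_on m setT (T n)) -> Cn_on m O lfsum.
Proof.
move=> Tm; apply: Cn_on_local => x Ox; have [N hN] := lfsum_near Ox.
exists [set y | \sum_(n < N) T n y = lfsum y]^°; split.
- exact: open_interior.
- exact: hN.
apply: (Cn_on_congr (f := fun y => \sum_(n < N) T n y)).
- exact: open_interior.
- by move=> y /interior_subset.
by apply: Cn_on_sum => n; exact: Cn_onS (Tm n).
Qed.

Hypothesis T_ge0 : forall n x, 0 <= T n x.

Lemma lfsum_ge n x : O x -> T n x <= lfsum x.
Proof.
move=> /lfsum_vanishes[N vN].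
have vM := vanishes_fromW (leq_maxl N n.+1) vN.
have nM : (n < maxn N n.+1)%N by rewrite leq_max ltnSn orbT.
rewrite (lfsumE vM) (bigD1 (Ordinal nM))//= lerDl.
by apply: sumr_ge0 => i _; exact: T_ge0.
Qed.

Hypothesis T_convex : forall n, convex_on setT (T n).

Lemma convex_on_lfsum :
  (forall x y t, O x -> O y -> 0 <= t <= 1 -> O (x + t *: (y - x))) ->
  convex_on O lfsum.
Proof.
move=> Oc x y t Ox Oy t01; have Oz := Oc x y t Ox Oy t01.
have [[Nx vx] [Ny vy] [Nz vz]] :=
  And3 (lfsum_vanishes Ox) (lfsum_vanishes Oy) (lfsum_vanishes Oz).
pose M := maxn Nx (maxn Ny Nz).
rewrite (lfsumE (vanishes_fromW (leq_maxl _ _ : Nx <= M)%N vx)).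
rewrite (lfsumE (@vanishes_fromW _ M _ _ vy)); last first.
  by rewrite !leq_max leqnn orbT.
rewrite (lfsumE (@vanishes_fromW _ M _ _ vz)); last first.
  by rewrite !leq_max leqnn !orbT.
exact: (convex_on_sum _ (fun i : 'I_M => T_convex i)).
Qed.

Lemma lfsum_even : (forall n x, T n (- x) = T n x) ->
  forall x, lfsum (- x) = lfsum x.
Proof.
move=> Te x.
have [[N vN]|nx] := pselect (exists N, vanishes_from N x).
  have vN' : vanishes_from N (- x) by move=> n /vN; rewrite Te.
  by rewrite (lfsumE vN) (lfsumE vN'); apply: eq_bigr => i _; exact: Te.
rewrite /lfsum; case: pselect => [[N vN]|_]; last by case: pselect.
by case: nx; exists N => n /vN; rewrite Te.
Qed.

End LocallyFiniteSum.

(** * The layers of caps and the approximating norm *)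

Section Approximation.
Context {R : realType} {X : completeNormedModType R}.
Context (N : X -> clin X R) (Xsep : separable X)
  (dN : forall x, x != 0 -> fderiv x (fun y => `|y|) (N x))
  (cN : forall x, x != 0 -> {for x, continuous N}).
Context (p : X -> R) (pn : is_norm p) (c K : R) (c0 : 0 < c) (K0 : 0 < K)
  (cp : forall x, c * `|x| <= p x) (pK : forall x, p x <= K * `|x|)
  (rho : R) (rho01 : 0 < rho < 1).

Let r0 : 0 < rho := proj1 (andP rho01).
Let r1 : rho < 1 := proj2 (andP rho01).

(** The [tau] of the overview, with [thin n] as its [eps_n]. Where [p x <= rho], also
    [c * |x| <= 1], so the term [slope * d n x] is at most [(1 - rho) / 2]; as
    [thin n <= (1 - rho) / 4], every cap vanishes there. *)
Definition slope : R := c * (1 - rho) / 2.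
Definition thin (n : nat) : R := (1 - rho) / 4 / n.+1%:R.
(** [penalty] and [mesh] are calibrated for [mesh_error]: flattening costs [thin n / 4] and the [n]
    Young terms together at most [thin n / 32], in total less than [thin n]. *)
Definition penalty (n : nat) : R := thin n / (8 * slope).
Definition mesh (n : nat) : R := thin n / (8 * n.+1%:R).

Lemma slope_gt0 : 0 < slope.
Proof. by rewrite divr_gt0// mulr_gt0// subr_gt0. Qed.

Lemma thin_gt0 n : 0 < thin n.
Proof. by rewrite !divr_gt0// subr_gt0. Qed.

Lemma penalty_gt0 n : 0 < penalty n.
Proof. by rewrite divr_gt0 ?thin_gt0// mulr_gt0// slope_gt0. Qed.

Lemma mesh_gt0 n : 0 < mesh n.
Proof. by rewrite divr_gt0 ?thin_gt0// mulr_gt0. Qed.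

Lemma thin_le n : thin n <= (1 - rho) / 4.
Proof.
rewrite /thin ler_pdivrMr// ler_peMr ?ler1n// divr_ge0// subr_ge0 ltW//.
Qed.

Lemma slope_penalty n : slope * penalty n = thin n / 8.
Proof. by rewrite /penalty; field; rewrite gt_eqF// slope_gt0. Qed.

Lemma thin_small (e : R) : 0 < e -> exists N, forall n, (N <= n)%N -> thin n <= e.
Proof.
move=> e0; have [k] := ltr_add_invr e0; rewrite add0r => ke.
exists k => n kn; apply: le_trans (ltW ke).
apply: (@le_trans _ _ n.+1%:R^-1).
  by rewrite /thin ler_piMl ?invr_ge0//; have := r0; lra.
by rewrite lef_pV2 ?posrE// ler_nat.
Qed.

Lemma mesh_error n :
  2 * slope * penalty n + n%:R * (mesh n ^+ 2 / (4 * slope * penalty n)) < thin n.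
Proof.
have s0 := slope_gt0; have t0 := thin_gt0 n.
have n0 : 0 < n.+1%:R :> R by [].
have -> : 4 * slope * penalty n = thin n / 2 by rewrite -mulrA slope_penalty; field.
have -> : 2 * slope * penalty n = thin n / 4 by rewrite -mulrA slope_penalty; field.
have -> : n%:R * (mesh n ^+ 2 / (thin n / 2)) =
    thin n / 32 * (n%:R / n.+1%:R) / n.+1%:R.
  by rewrite /mesh; field; rewrite nat1r (gt_eqF n0) (gt_eqF t0).
have h : thin n / 32 * (n%:R / n.+1%:R) / n.+1%:R <= thin n / 32.
  rewrite ler_pdivrMr// (@le_trans _ _ (thin n / 32))//.
    apply: ler_piMr; first by rewrite divr_ge0// ltW.
    by rewrite ler_pdivrMr// mul1r ler_nat.
  by apply: ler_peMr; [rewrite divr_ge0// ltW|rewrite ler1n].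
by apply: le_lt_trans (lerD (lexx _) h) _; lra.
Qed.

Context (e : nat -> X) (g : nat -> clin X R) (d : nat -> X -> R)
  (F : nat -> seq (clin X R)).
Context (e_dense : forall x r, 0 < r -> exists i, `|x - e i| < r)
  (g_dense : forall f r, 0 < r -> exists j, `|f - g j| < r).
Context (dd : forall n, distlike (d n)) (d0 : forall n, d n 0 = 0)
  (de : forall n x y, y \in mkseq e n -> d n x <= `|x - y| + penalty n)
  (dh : forall n gamma (h : clin X R) x, `|h| <= slope ->
     (forall y, y \in mkseq e n -> `|h y| <= gamma) ->
     h x <= slope * d n x + 2 * slope * penalty n
        + n%:R * (gamma ^+ 2 / (4 * slope * penalty n))).
Context (Fp : forall n f, f \in F n -> forall y, f y <= p y)
  (Fnet : forall (f : clin X R) j n, (forall y, f y <= p y) ->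
    `|f - g j| <= slope / 2 -> (j < n)%N -> exists2 f', f' \in F n &
      `|f - f'| <= 2 * (slope / 2) /\
      forall y, y \in mkseq e n -> `|(f - f') y| <= mesh n).

(* Normalized so that [cap n f x = 2] when [f x + slope * d n x = 1 - thin n]. *)
Definition cap n (f : clin X R) x : R :=
  2 / ramp (thin n) * ramp (f x + slope * d n x + (2 * thin n - 1)).

(** Pairing the caps of [f] and [- f] makes the layer even, whether or not [F n] is symmetric. *)
Definition layer n x : R := \sum_(f <- F n) (cap n f x + cap n (- f) x).

Lemma cap_ge0 n f x : 0 <= cap n f x.
Proof. by rewrite mulr_ge0 ?ramp_ge0// divr_ge0// ramp_ge0. Qed.

Lemma layer_ge0 n x : 0 <= layer n x.
Proof. by apply: sumr_ge0 => f _; rewrite addr_ge0// cap_ge0. Qed.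

Lemma layer_even n x : layer n (- x) = layer n x.
Proof.
apply: eq_bigr => f _; rewrite /cap (distlike_even (dd n)) addrC.
have E1 : f (- x) = (- f) x by exact: clin_oppv.
have E2 : (- f) (- x) = f x by rewrite clin_oppv clinN opprK.
by rewrite E1 E2.
Qed.

Lemma layer_convex n : convex_on setT (layer n).
Proof.
have capc f : convex_on setT (cap n f).
  apply: convex_on_ramp => //; first by rewrite divr_ge0// ramp_ge0.
  apply: convex_onD; first exact: convex_on_clin.
  by apply: convex_onZ; [exact/ltW/slope_gt0|exact: distlike_convex].
by apply: convex_on_sum => f; apply: convex_onD.
Qed.

Lemma Cn_on_layer m n : Cn_on m setT (d n) -> Cn_on m setT (layer n).
Proof.
move=> dn; have capn f : Cn_on m setT (cap n f).
  apply: Cn_on_ramp_comp; apply: Cn_onD; first exact: Cn_on_clin.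
  by apply: Cn_onM => //; exact: Cn_on_cst.
by apply: Cn_on_sum => f; apply: Cn_onD.
Qed.

Lemma layer_eq0 n x : p x + slope * d n x <= 1 - 2 * thin n -> layer n x = 0.
Proof.
move=> px; have cap0 (f : clin X R) : f x <= p x -> cap n f x = 0.
  by move=> fp; rewrite /cap [ramp (_ + _)]ramp_le0 ?mulr0//; lra.
rewrite /layer big_seq big1// => f /Fp fp.
rewrite !cap0 ?addr0//.
by rewrite clinN -clin_oppv -(is_normN x pn).
Qed.

Lemma d_le n x : d n x <= `|x|.
Proof. by have := distlike_lip (dd n) 0 x; rewrite d0 !subr0. Qed.

Lemma layer_eq0_rho n x : p x <= rho -> layer n x = 0.
Proof.
move=> px; apply: layer_eq0.
have h1 : slope * d n x <= (1 - rho) / 2.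
  apply: (@le_trans _ _ (slope * `|x|)); first by rewrite ler_pM2l ?slope_gt0// d_le.
  have : c * `|x| <= 1 by rewrite (le_trans (cp x))// (le_trans px)// ltW.
  rewrite /slope; have : 0 < 1 - rho by rewrite subr_gt0.
  by move=> a b; have := ler_wpM2l (ltW a) b; lra.
by have := thin_le n; lra.
Qed.

Let O := [set x | p x < 1].

Lemma layer_locally_finite x : O x ->
  exists N, \forall y \near x, vanishes_from layer N y.
Proof.
move=> Ox; pose m := 1 - p x; have m0 : 0 < m by rewrite subr_gt0.
have s0 := slope_gt0.
(* The margin [m] is shared out: a quarter for the distance from [x] to a dense point, a quarter for
   moving from [x] to [y], and the rest for the multiples of [thin n <= m / 12]. The bound [i.+1]
   puts [e i] in [mkseq e n]. *)
have ms0 : 0 < m / 4 / slope by rewrite divr_gt0// divr_gt0.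
have [i hi] := e_dense x ms0.
have m12 : 0 < m / 12 by rewrite divr_gt0.
have [M hM] := thin_small m12.
have Ks : 0 < K + slope by rewrite addr_gt0.
have rr : 0 < m / 4 / (K + slope) by rewrite !divr_gt0.
exists (maxn M i.+1).
apply: filterS (nbhs_dist_le x rr) => y hy n; rewrite geq_max => /andP[Mn i_n].
apply: layer_eq0.
have h1 : p y - p x <= K * `|y - x| by rewrite (le_trans (is_norm_sub _ _ pn)).
have h2 := distlike_lip (dd n) x y.
have h3 : d n x <= `|x - e i| + penalty n.
  by apply: de; apply/mapP; exists i; rewrite ?mem_iota.
have h4 : slope * d n y <= slope * (m / 4 / slope + penalty n + `|y - x|).
  by rewrite ler_pM2l//; move: hi h2 h3; move: (m / 4 / slope) => q; lra.
rewrite !mulrDr slope_penalty [slope * (_ / _)]mulrC divfK ?gt_eqF// in h4.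
have h5 : (K + slope) * `|y - x| <= m / 4 by rewrite mulrC -ler_pdivlMr.
have := hM n Mn; rewrite /m in m0 h4 h5 *; lra.
Qed.

Lemma layer_large x : p x = 1 -> exists n, 1 < layer n x.
Proof.
move=> px; have [pD pZ _] := pn.
have sp : sublinear p.
  by split => // a y a0; rewrite pZ ger0_norm.
have [f fp fx] := support_functional x sp pK.
have s2 : 0 < slope / 2 by rewrite divr_gt0 ?slope_gt0.
have [j /ltW fj] := g_dense f s2.
(* The least index at which [Fnet] covers the ball about [g j]. Its radius [slope / 2] puts [f']
   within [slope] of [f]. *)
exists j.+1; set n := j.+1.
have [f' f'F [ff' f'e]] := Fnet fp fj (ltnSn j).
rewrite mulrC divfK ?pnatr_eq0// in ff'.
have h2 : 1 - f' x < slope * d n x + thin n.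
  have := dh x ff' f'e; rewrite clinB fx px -addrA => h1.
  by apply: (le_lt_trans h1); rewrite ltrD2l; exact: mesh_error.
have h3 : thin n <= f' x + slope * d n x + (2 * thin n - 1) by lra.
apply: (@lt_le_trans _ _ (cap n f' x)).
  apply: (@lt_le_trans _ _ 2); first by rewrite ltr1n.
  have t0 : 0 < ramp (thin n) by rewrite ramp_gt0// thin_gt0.
  rewrite /cap mulrAC ler_pdivlMr// ler_pM2l//.
  exact: ramp_mono.
rewrite /layer (big_rem f')//= -addrA lerDl addr_ge0 ?cap_ge0//.
by apply: sumr_ge0 => k _; rewrite addr_ge0// cap_ge0.
Qed.

Lemma layer_continuous n : continuous (layer n).
Proof.
move=> x; apply: (@Cn_on_layer 0) => // y _.
exact: lip1_continuous (distlike_lip (dd n)) y.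
Qed.

(** Local finiteness is available only where [p < 1], so the large value on the sphere is carried
    inwards along the ray by continuity of a single layer, which bounds the sum from below. *)
Lemma lfsum_layer_large x : p x = 1 ->
  exists2 t, 0 < t < 1 & 1 < lfsum layer (t *: x).
Proof.
move=> px; have [n ln] := layer_large px; have [_ pZ _] := pn.
have lc : {for (1 : R), continuous (fun t : R => layer n (t *: x))}.
  apply: (@continuous_comp _ _ _ (fun t : R => t *: x) (layer n)).
    by apply: cvgZr_tmp; exact: cvg_id.
  exact: layer_continuous.
have /lc : \forall y \near layer n (1 *: x), 1 < y.
  by rewrite scale1r; apply: open_nbhs_nbhs; split => //; exact: open_gt.
move=> /nbhs_ballP[r /= rr hr].
pose t := Num.max (1 / 2) (1 - r / 2).
have t0 : 0 < t by rewrite lt_max divr_gt0.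
have t1 : t < 1 by rewrite gt_max; apply/andP; split; lra.
exists t; first by rewrite t0.
have Ot : O (t *: x) by rewrite /O /= pZ px mulr1 gtr0_norm.
apply: lt_le_trans (lfsum_ge layer_locally_finite layer_ge0 n Ot).
apply: hr; rewrite -ball_normE /= gtr0_norm ?subr_gt0//.
have : 1 - r / 2 <= t by rewrite le_max lexx orbT.
lra.
Qed.

Context (dn : forall m n, Cn_on m.+1 (~` [set 0]) (fun x : X => `|x|) ->
  Cn_on m.+1 setT (d n)).

Lemma smooth_norm_between : exists q, [/\ is_norm q,
  forall x, p x <= q x, forall x, q x <= rho^-1 * p x &
  forall m, Cn_on m.+1 (~` [set 0]) (fun x : X => `|x|) ->
    Cn_on m.+1 (~` [set 0]) q].
Proof.
have Oconv x y t : O x -> O y -> 0 <= t <= 1 -> O (x + t *: (y - x)).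
  rewrite /O /= => Ox Oy /andP[t0 t1]; have [pD pZ _] := pn.
  have -> : x + t *: (y - x) = (1 - t) *: x + t *: y.
    by rewrite scalerBl scale1r scalerBr addrA addrAC.
  apply: le_lt_trans (pD _ _) _; rewrite !pZ !ger0_norm ?subr_ge0//.
  apply: (@le_lt_trans _ _ (Num.max (p x) (p y))); last by rewrite gt_max Ox Oy.
  have hx : (1 - t) * p x <= (1 - t) * Num.max (p x) (p y).
    by rewrite ler_wpM2l ?subr_ge0// le_max lexx.
  have hy : t * p y <= t * Num.max (p x) (p y).
    by rewrite ler_wpM2l// le_max lexx orbT.
  lra.
have Phic := convex_on_lfsum layer_locally_finite layer_convex Oconv.
have Phie := lfsum_even layer_even.
have Phict x : O x -> {for x, continuous (lfsum layer)}.
  move=> Ox; apply: (Cn_on_lfsum (m := 0) layer_locally_finite) => // n y _.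
  exact: layer_continuous.
have Phi0 x : p x <= rho -> lfsum layer x = 0.
  move=> px; rewrite (@lfsumE _ _ _ 0%N) ?big_ord0// => n _.
  exact: layer_eq0_rho.
exists (gauge pn rho01 Phict Phi0 lfsum_layer_large); split.
- exact: gauge_norm.
- exact: gauge_ge.
- exact: gauge_le_norm.
move=> m nm; apply: (Cn_on_gauge pn pK) => //.
by apply: (Cn_on_lfsum layer_locally_finite) => n; apply: Cn_on_layer; exact: dn.
Qed.

End Approximation.

Lemma norm_approximation (R : realType) (X : completeNormedModType R) :
  separable X -> Cn_on 1 (~` [set 0]) (fun x : X => `|x|) ->
  forall p : X -> R, is_norm p -> norm_equiv p (fun x : X => `|x|) ->
  forall rho : R, 0 < rho < 1 -> exists q : X -> R, [/\ is_norm q,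
    forall x, p x <= q x, forall x, q x <= rho^-1 * p x &
    forall m, Cn_on m.+1 (~` [set 0]) (fun x : X => `|x|) ->
      Cn_on m.+1 (~` [set 0]) q].
Proof.
move=> Xsep [N Nd Nc] p pn [c [K [c0 K0 cpK]]] rho rho01.
have dN x : x != 0 -> fderiv x (fun y => `|y|) (N x).
  by move=> /eqP x0; apply/is_diffE; exact: Nd.
have cN x : x != 0 -> {for x, continuous N}.
  by move=> /eqP x0; exact: Nc.
have [e he] := separable_seq Xsep.
have [g hg] := dual_separable Xsep dN cN.
have cp x : c * `|x| <= p x by have /andP[] := cpK x.
have pK x : p x <= K * `|x| by have /andP[] := cpK x.
have s0 : 0 < slope c rho := slope_gt0 c0 rho01.
have /choice[d hd] n :=
  smoothed_distance (mkseq e n) (penalty_gt0 c0 rho01 n).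
have [F [Fp Fnet]] :=
  functional_nets e g (slope c rho / 2) pK (mesh_gt0 rho01).
apply: (@smooth_norm_between _ _ p pn c K c0 K0 cp pK rho rho01 e g d F) => //.
- by move=> n; have [] := hd n.
- by move=> n; have [] := hd n.
- by move=> n; have [] := hd n.
- move=> n gamma h x hs he'; have [_ _ _ _ dh] := hd n.
  by have := dh (slope c rho) gamma h x s0 hs he'; rewrite size_mkseq.
by move=> m n nm; have [_ _ dn _ _] := hd n; exact: dn.
Qed.

Theorem theorem2p8 (R : realType) (X : completeNormedModType R)
    (k : option nat) (hk : k <> Some 0%N)
    (Xsep : separable X)
    (Xsmooth : smooth_norm k (fun x : X => `|x|)) :
  forall p : X -> R, is_norm p -> norm_equiv p (fun x : X => `|x|) ->
  forall B : set X, bounded_set B ->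
  forall delta : R, 0 < delta ->
  exists q : X -> R,
    [/\ is_norm q, norm_equiv q (fun x : X => `|x|), smooth_norm k q
      & forall x, B x -> `|p x - q x| <= delta].
Proof.
move=> p pn pe B Bb delta delta0.
have C1 : Cn_on 1 (~` [set 0]) (fun x : X => `|x|).
  case: k hk Xsmooth => [[//|n] _|_] Xs; last exact: (Xs 1%N).
  exact: (@Cn_on_leq R X 1 n.+1 _ _ (fun x : X => `|x|) isT Xs).
have [c [K [c0 K0 cpK]]] := pe.
have [M M0 BM] : exists2 M, 0 < M & forall x, B x -> `|x| <= M.
  have /pinfty_ex_gt0[M M0 hM] := Bb.
  by exists M => // x Bx; exact: hM.
(* Chosen so that [rho^-1 - 1 = delta / (K * M)]: as [p <= K * M] on [B], the relative error becomes
   an absolute error of at most [delta]. *)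
pose rho := (1 + delta / (K * M))^-1.
have KM : 0 < K * M by rewrite mulr_gt0.
have dKM : 0 < delta / (K * M) by rewrite divr_gt0.
have r1 : 1 < 1 + delta / (K * M) by rewrite ltrDl.
have rho01 : 0 < rho < 1 by rewrite invr_gt0 (lt_trans ltr01)//= invf_lt1// (lt_trans ltr01).
have [q [qn pq qp qs]] := norm_approximation Xsep C1 pn pe rho01.
exists q; split => //.
- exists c, (rho^-1 * K); split => // [|x].
    by rewrite mulr_gt0// invr_gt0; case/andP: rho01.
  have /andP[cp pK] := cpK x; rewrite (le_trans cp (pq x))/=.
  rewrite (le_trans (qp x))// -mulrA ler_pM2l// invr_gt0.
  by case/andP: rho01.
- case: k hk Xsmooth => [[//|n] _|_] /= Xs; first exact: qs.
  (* For infinite order, [q] is fixed before the order; since [qs] speaks of positive orders, order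
     [n] is read off from order [n.+1]. *)
  by move=> n; apply: Cn_onW; apply: qs; exact: Xs.
move=> x Bx; rewrite distrC ger0_norm ?subr_ge0//.
have := qp x; rewrite /rho invrK mulrDl mul1r -lerBlDl => h.
rewrite (le_trans h)// mulrAC ler_pdivrMr// ler_wpM2l ?(ltW delta0)//.
have /andP[_ pK] := cpK x; rewrite (le_trans pK)// ler_wpM2l ?(ltW K0)//.
exact: BM.
Qed.
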